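(* Let $a$ be a fixed positive integer. Then the normal order of $\log R(n;a)$ as a function of $n$ is $(\log 3)\log\log n$; that is, for every $\varepsilon>0$, the number of integers $n$ with $3\le n\le N$ for which the inequality $$\big|\log R(n;a)-(\log 3)\log\log n\big|\le \varepsilon\,(\log 3)\log\log n$$ fails is $o(N)$ as $N\to\infty$.
   Context: For positive integers $n,a$, $R(n;a)$ denotes the number of ordered pairs $(x,y)$ of positive integers with $\frac an=\frac1x+\frac1y$. Here $n$ is not required to be coprime to $a$. Convention: if $R(n;a)=0$ then $\log R(n;a)=-\infty$, so the displayed inequality is regarded as failing for such $n$. *)

(* Defs.v *)
From mathcomp Require Import all_boot all_order all_algebra finmap.
From mathcomp Require Import zify lra ring.
From mathcomp Require Import all_classical all_reals all_analysis.
Import Order.TTheory GRing.Theory Num.Theory numFieldNormedType.Exports.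

Set Implicit Arguments.
Unset Strict Implicit.
Unset Printing Implicit Defensive.

Local Open Scope classical_set_scope.
Local Open Scope ring_scope.

Definition egyptian_pairs (n a : nat) : set (nat * nat) :=
  [set xy | [/\ (0 < xy.1)%N, (0 < xy.2)%N &
     a%:R / n%:R = xy.1%:R^-1 + xy.2%:R^-1 :> rat]].

(** [fset_set] yields the empty set on infinite sets; for positive [n], [a] finiteness is
    [finite_egyptian_pairs]. *)
Definition num_egyptian_pairs (n a : nat) : nat :=
  #|` fset_set (egyptian_pairs n a)|%fset.

Lemma finite_egyptian_pairs (n a : nat) :
  (0 < n)%N -> (0 < a)%N -> finite_set (egyptian_pairs n a).
Proof.
move=> n0 a0.
apply: (@sub_finite_set _ _ (`I_(n ^ 2 + n).+1 `*` `I_(n ^ 2 + n).+1));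
  last by apply: finite_setX; exact: finite_II.
move=> [x y] [/= x0 y0 E].
have {}E : (a * (x * y) = n * (x + y))%N.
  apply/eqP; rewrite -(eqr_nat rat) !natrM natrD.
  have nz (k : nat) : (0 < k)%N -> k%:R != 0 :> rat by rewrite pnatr_eq0 -lt0n.
  have := nz _ n0; have := nz _ x0; have := nz _ y0 => hy hx hn.
  have -> : a%:R = n%:R * (x%:R^-1 + y%:R^-1) :> rat.
    by rewrite -E mulrCA mulfV // mulr1.
  by apply/eqP; field; rewrite hx hy.
have hx : (n < a * x)%N by nia.
have hy : (n < a * y)%N by nia.
have key : ((a * x - n) * (a * y - n) = n ^ 2)%N by nia.
split => /=; rewrite /mkset; nia.
Qed.

(** Extended-real values of [f] accommodate [ln 0 = -oo]; at such points the
    inequality is false. *)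
Definition normal_order (R : realType) (f : nat -> \bar R) (g : nat -> R) :=
  forall eps : R, 0 < eps ->
    (fun N : nat => (count
       (fun n => ~~ (`|f n - (g n)%:E| <= (eps * g n)%:E)%E)
       (index_iota 3 N.+1))%:R : R) =o_\oo (fun N : nat => N%:R : R).

(* Main.v *)
(** Write E(N) for the sum of 1/p over primes p <= N, and d = gcd(n, a).
    Since (a x - n)(a y - n) = n^2, R(n; a) is at most the number of divisors
    of n^2, hence at most 3^Omega(n).  Conversely R(n; a) is at least the
    number of divisors u of (n/d)^2 with u = - n/d modulo a/d.  If boundedly
    many primes of n have products covering every unit class modulo a, any
    choice of exponents 0, 1, 2 on the remaining primes coprime to a extends to
    such a u, so R(n; a) >= 3^(omega(n) - O(1)).

    For almost all n such a covering family exists: as long as the set S of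
    classes of divisors of the product found so far is not everything, some
    unit c fails to map S into itself; the residues preserving S form a
    submonoid, and the reciprocals of the primes outside a proper submonoid have
    a divergent sum.  This divergence needs no L-functions: if the sum converged,
    discarding finitely many primes p <= z would make almost all integers prime
    to M = a * prod p (in logarithmic weight) lie in the submonoid, whereas
    multiplication by an outside unit shows that at least half of the reduced
    classes modulo M lie outside it.

    The Turan-Kubilius inequality concentrates omega around E(N), the mean of
    Omega - omega is bounded, and E(N) is asymptotic to ln ln N. *)
Require Import Defs.
From mathcomp Require Import all_boot all_order all_algebra cyclic finmap.
From mathcomp Require Import zify lra ring.
From mathcomp Require Import all_classical all_reals all_analysis.
Import Order.TTheory GRing.Theory Num.Theory numFieldNormedType.Exports.
Set Implicit Arguments.
Unset Strict Implicit.
Unset Printing Implicit Defensive.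

(** * Representations and divisors in residue classes *)

Lemma leq_count_in (T : eqType) (s : seq T) (P Q : pred T) :
  {in s, forall x, P x -> Q x} -> (count P s <= count Q s)%N.
Proof.
move=> PQ; rewrite (@eq_in_count _ P (predI P Q)) => [|x xs /=].
  by apply: sub_count => x /andP[].
by case: (boolP (P x)) => //= /(PQ _ xs) ->.
Qed.

Lemma coprime_primeP (m n : nat) : (0 < n)%N ->
  (forall p, prime p -> p %| m -> p %| n -> False) -> coprime m n.
Proof.
move=> n0 h; apply: contraT; rewrite /coprime => g1.
have g0 : (0 < gcdn m n)%N by rewrite gcdn_gt0 n0 orbT.
have pg := pdiv_dvd (gcdn m n).
have gp : prime (pdiv (gcdn m n)) by apply: pdiv_prime; lia.
by case: (h _ gp); [exact: dvdn_trans pg (dvdn_gcdl _ _) | exact: dvdn_trans pg (dvdn_gcdr _ _)].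
Qed.

(* The multiplier is the part of M prime to c, so that every prime divisor of M
   divides exactly one of the two summands. *)
Lemma coprime_lift (c q M : nat) :
  coprime c q -> (0 < M)%N -> exists t, coprime (c + q * t) M.
Proof.
move=> cq M0; pose pi : nat_pred := [pred p : nat | ~~ (p %| c)].
exists (M`_pi)%N; apply: coprime_primeP => // p pp pd pM.
have [pc|npc] := boolP (p %| c)%N.
- move: pd; rewrite dvdn_addr// Euclid_dvdM// => /orP[pq|pt].
    have : (p %| gcdn c q)%N by rewrite dvdn_gcd pc.
    by rewrite (eqP cq) dvdn1 => /eqP pE; move: pp; rewrite pE.
  have := part_pnat pi M => /pnatP.
  by move=> /(_ (part_gt0 _ _)) /(_ p pp pt); rewrite inE /= pc.
- have pt : (p %| M`_pi)%N.
    have ppi : pi.-nat p by rewrite pnatE// inE.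
    by rewrite -(part_pnat_id ppi) partn_dvd.
  by move: pd; rewrite dvdn_addl ?(negPf npc)// dvdn_mull.
Qed.

Lemma coprime_mod_solve (a p c : nat) : (0 < a)%N -> coprime p a -> coprime c a ->
  exists2 c', coprime c' a & p * c' = c %[mod a].
Proof.
move=> a0 pa ca; exists (c * p ^ (totient a).-1)%N.
  by rewrite coprimeMl ca coprimeXl.
rewrite mulnCA -expnS prednK ?totient_gt0//.
by rewrite -modnMmr Euler_exp_totient// modnMmr muln1.
Qed.

Section residues.
Variable a : nat.
Hypothesis a_gt0 : (0 < a)%N.

Definition residue (n : nat) : 'I_a := Ordinal (ltn_pmod n a_gt0).

Lemma residue_eq m n : m = n %[mod a] -> residue m = residue n.
Proof. by move=> E; apply: val_inj. Qed.

(** For fixed [S] these [n] form a multiplicative submonoid that is determined modulo [a], the shape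
    to which [prime_recip_unbounded] applies. *)
Definition stabilizes (S : {set 'I_a}) (n : nat) : bool :=
  [forall s in S, exists t in S, (n * s) %% a == t].

Definition divisor_residues (m : nat) : {set 'I_a} :=
  [set s : 'I_a | has (fun u => u %% a == s) (divisors m)].

Lemma stabilizesP (S : {set 'I_a}) (n : nat) :
  reflect (forall s, s \in S -> residue (n * s) \in S)
    (stabilizes S n).
Proof.
apply: (iffP forall_inP) => h s sS.
  have /exists_inP[t tS /eqP E] := h s sS.
  suff <- : t = residue (n * s) by []; exact: val_inj.
by apply/exists_inP; exists (residue (n * s)); rewrite ?h.
Qed.

Lemma stabilizes1 S : stabilizes S 1.
Proof.
apply/stabilizesP => s sS; suff -> : residue (1 * s) = s by [].
by apply: val_inj => /=; rewrite mul1n modn_small.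
Qed.

Lemma stabilizesM S m n : stabilizes S m -> stabilizes S n -> stabilizes S (m * n).
Proof.
move=> /stabilizesP hm /stabilizesP hn; apply/stabilizesP => s sS.
rewrite -mulnA (@residue_eq _ (m * residue (n * s))) ?hm ?hn//.
by rewrite /= modnMmr.
Qed.

Lemma stabilizes_mod S m n : m = n %[mod a] -> stabilizes S m = stabilizes S n.
Proof.
move=> E; apply: eq_forallb_in => s _; apply: eq_existsb_in => t _.
by rewrite -modnMml E modnMml.
Qed.

Lemma divisor_residuesP m (s : 'I_a) :
  reflect (exists2 u, u \in divisors m & u %% a = s) (s \in divisor_residues m).
Proof.
rewrite inE; apply: (iffP hasP) => -[u um E]; exists u => //; first exact/eqP.
by rewrite E.
Qed.

(** Greedy choice of primes. A unit [c] missed by the residue set [S] of the current product carries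
    1, which lies in [S], outside it, so the hypothesis supplies [a] primes that do not stabilize
    [S]. One of them is new, as fewer than [a] have been used, and adjoining it enlarges [S]. There
    are only [a] classes, so the process ends. *)
Lemma divisor_residues_cover (n : nat) :
  (forall (S : {set 'I_a}) c, coprime c a -> ~~ stabilizes S c ->
     exists ps, [/\ uniq ps, size ps = a &
       all (fun p => [&& prime p, p %| n, coprime p a & ~~ stabilizes S p]) ps]) ->
  exists T, [/\ uniq T, size T <= a,
    all (fun p => [&& prime p, p %| n & coprime p a]) T &
    forall c, coprime c a ->
      exists2 u, u \in divisors (\prod_(p <- T) p) & u = c %[mod a] ].
Proof.
move=> h.
suff main j : (j <= a)%N -> exists T, [/\ uniq T, size T <= j,
    all (fun p => [&& prime p, p %| n & coprime p a]) T &
    (forall c, coprime c a ->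
      exists2 u, u \in divisors (\prod_(p <- T) p) & u = c %[mod a])
    \/ (j < #|divisor_residues (\prod_(p <- T) p)|)%N].
  have [T [uT sT aT hT]] := main a (leqnn a); exists T; split => //.
  case: hT => // /leq_trans /(_ (max_card _)).
  by rewrite card_ord ltnn.
have one m : (0 < m)%N -> residue 1 \in divisor_residues m.
  by move=> m0; apply/divisor_residuesP; exists 1%N => //; rewrite -dvdn_divisors.
elim: j => [_|j IH ja].
  exists [::]; split => //; right; rewrite big_nil.
  by apply/card_gt0P; exists (residue 1); apply: one.
have [T [uT sT aT hT]] := IH (ltnW ja).
set m := (\prod_(p <- T) p)%N in hT *.
have m0 : (0 < m)%N.
  rewrite /m big_seq prodn_cond_gt0// => p pT.
  by apply: prime_gt0; case/and3P: (allP aT _ pT).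
have [|hno] := pselect (forall c, coprime c a ->
  exists2 u, u \in divisors m & u = c %[mod a]).
  by move=> hc; exists T; split => //; [exact: leqW|left].
case: hT => [//|hT].
have [c [cc cm]] : exists c, coprime c a /\
    residue c \notin divisor_residues m.
  apply: contrapT => hn; apply: hno => c cc.
  have [/divisor_residuesP[u um uc]|] :=
    boolP (residue c \in divisor_residues m); first by exists u.
  by move=> ncm; case: hn; exists c.
have nst : ~~ stabilizes (divisor_residues m) c.
  apply/stabilizesP => /(_ _ (one m m0)); apply/negP.
  by rewrite (@residue_eq _ c)//= modnMmr muln1.
have [ps [ups sps aps]] := h _ _ cc nst.
have [p pps pT] : exists2 p, p \in ps & p \notin T.
  apply: contrapT => hn; have : (size ps <= size T)%N.
    apply: uniq_leq_size => // p pps; apply: contraT => pT.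
    by case: hn; exists p.
  by rewrite sps leqNgt (leq_ltn_trans sT ja).
have /and4P[pp pn pa pst] := allP aps _ pps.
exists (p :: T); split; rewrite /= ?pT ?pp ?pn ?pa//.
right; rewrite big_cons -/m; apply: leq_ltn_trans hT _; apply: proper_card.
apply/properP; split.
  apply/fintype.subsetP => s /divisor_residuesP[u um us]; apply/divisor_residuesP.
  exists u => //; move: um; rewrite -!dvdn_divisors ?muln_gt0 ?(prime_gt0 pp) ?m0//.
  exact: dvdn_mull.
have [s [sm psm]] : exists s, s \in divisor_residues m /\
    residue (p * s) \notin divisor_residues m.
  apply: contrapT => hn; move: pst => /stabilizesP; apply => s sm.
  by apply: contraT => psm; case: hn; exists s.
exists (residue (p * s)) => //.
have /divisor_residuesP[u um us] := sm; apply/divisor_residuesP.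
exists (p * u)%N; last by rewrite /= -us modnMmr.
move: um; rewrite -!dvdn_divisors ?muln_gt0 ?(prime_gt0 pp) ?m0// => um.
exact: dvdn_mul.
Qed.
End residues.

(** Since [p] does not divide [m], the multiples u, p u, p^2 u of divisors u of [m ^ 2] form
    disjoint families. To land in the class of [c], u is taken in the classes of c, c / p, c / p^2,
    all of them units. *)
Lemma count_divisors_residue_step (a p m K : nat) :
  (0 < a)%N -> (0 < m)%N -> prime p -> coprime p m -> coprime p a ->
  (forall c, coprime c a ->
     (K <= count (fun u => u == c %[mod a]) (divisors (m ^ 2)))%N) ->
  forall c, coprime c a ->
    (3 * K <= count (fun u => u == c %[mod a]) (divisors ((p * m) ^ 2)))%N.
Proof.
move=> a0 m0 pp pm pa hK c ca.
have [c1 c1a E1] := coprime_mod_solve a0 pa ca.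
have [c2 c2a E2] := coprime_mod_solve a0 pa c1a.
have p0 := prime_gt0 pp; have p1 := prime_gt1 pp.
have m2 : (0 < m ^ 2)%N by rewrite expn_gt0 m0.
have pm2 : (0 < (p * m) ^ 2)%N by rewrite expn_gt0 muln_gt0 p0 m0.
have npu u : u \in divisors (m ^ 2) -> ~~ (p %| u)%N.
  rewrite -dvdn_divisors// => um; apply/negP => pu.
  have : (p %| m ^ 2)%N := dvdn_trans pu um.
  by rewrite Euclid_dvdX//= andbT -[_ %| _]negbK -prime_coprime// pm.
pose s c := [seq u <- divisors (m ^ 2) | u == c %[mod a]].
have us d : uniq (s d) by rewrite filter_uniq// divisors_uniq.
rewrite -size_filter.
have -> : (3 * K = K + (K + K))%N by lia.
pose t := s c ++ ([seq p * u | u <- s c1] ++ [seq p * (p * u) | u <- s c2])%N.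
apply: (@leq_trans (size t)).
  by rewrite !size_cat !size_map !size_filter !leq_add ?hK.
apply: uniq_leq_size.
  have ip : injective (muln p) by move=> x y /eqP; rewrite eqn_pmul2l// => /eqP.
  rewrite /t !cat_uniq us (map_inj_uniq ip) us map_inj_uniq ?us /=; last first.
    by move=> x y /ip/ip.
  rewrite andbT; apply/andP; split; apply/hasPn => x.
    rewrite mem_cat => /orP[] /mapP[u _ ->]; rewrite mem_filter negb_and orbC.
      by apply/orP; left; apply/negP => /npu; rewrite dvdn_mulr.
    by apply/orP; left; apply/negP => /npu; rewrite dvdn_mulr.
  move=> /mapP[u _ ->]; apply/mapP => -[v]; rewrite mem_filter => /andP[_ /npu].
  by move=> /negP + /ip E; rewrite -E dvdn_mulr.
move=> x; rewrite mem_filter -dvdn_divisors// expnMn /t !mem_cat.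
case/or3P => [|/mapP[u + ->]|/mapP[u + ->]]; rewrite mem_filter -dvdn_divisors// =>
    /andP[/eqP uc um].
- by rewrite uc eqxx dvdn_mull.
- by rewrite -modnMmr uc modnMmr E1 eqxx dvdn_mul// dvdn_exp.
- rewrite mulnA -modnMmr uc modnMmr -mulnA -modnMmr E2 modnMmr E1 eqxx.
  by rewrite -mulnn dvdn_mul.
Qed.

(** Each prime of [ps] triples the count in every unit class at once. The factor [m] starts the
    induction, having a divisor in each unit class. *)
Lemma count_divisors_residue (a m : nat) (ps : seq nat) :
  (0 < a)%N -> (0 < m)%N -> uniq ps ->
  all (fun p => [&& prime p, coprime p m & coprime p a]) ps ->
  (forall c, coprime c a -> exists2 u, u \in divisors m & u = c %[mod a]) ->
  forall c, coprime c a ->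
    (3 ^ size ps <=
     count (fun u => u == c %[mod a]) (divisors ((m * \prod_(p <- ps) p) ^ 2)))%N.
Proof.
move=> a0 m0 + + hm; elim: ps => [_ _ c /hm[u um /eqP uc]|p ps IH /=].
  rewrite big_nil muln1 -has_count; apply/hasP; exists u => //.
  by move: um; rewrite -!dvdn_divisors ?expn_gt0 ?m0// => um; rewrite dvdn_mulr.
move=> /andP[pps ups] /andP[/and3P[pp pm pa] aps] c ca.
rewrite big_cons mulnCA expnS.
apply: count_divisors_residue_step => //; last by move=> ? ?; apply: IH.
- rewrite muln_gt0 m0 big_seq prodn_cond_gt0// => q qps.
  by apply: prime_gt0; case/and3P: (allP aps _ qps).
- rewrite coprimeMr pm big_seq /=; apply: (big_ind (fun x => coprime p x)).
  + exact: coprimen1.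
  + by move=> x y px py; rewrite coprimeMr px.
  + move=> q qps; have /and3P[qp _ _] := allP aps _ qps.
    rewrite prime_coprime// dvdn_prime2//.
    by apply: contraNneq pps => ->.
Qed.

(** A divisor of [p * k] divides [k] or is [p] times a divisor of [k]; applied twice, this also
    covers the case where [p] divides [m]. *)
Lemma divisors_mul_prime_sqr (p m : nat) : prime p -> (0 < m)%N ->
  (size (divisors (p * (p * m))) <= 3 * size (divisors m))%N.
Proof.
move=> pp m0; have p0 := prime_gt0 pp.
set s := divisors m.
have -> : (3 * size s =
    size (s ++ ([seq p * u | u <- s] ++ [seq p * (p * u) | u <- s])))%N.
  by rewrite !size_cat !size_map; lia.
apply: uniq_leq_size; first exact: divisors_uniq.
have split_dvd k u : (u %| p * k)%N -> (u %| k)%N \/ exists2 v, u = (p * v)%N & (v %| k)%N.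
  move=> uk; have [/dvdnP[v uE]|npu] := boolP (p %| u)%N.
    right; exists v; first by rewrite mulnC.
    by move: uk; rewrite uE mulnC dvdn_pmul2l.
  by left; rewrite -(@Gauss_dvdr _ p)// coprime_sym prime_coprime.
move=> x; rewrite -dvdn_divisors ?muln_gt0 ?p0// !mem_cat.
have inl u : (u %| m)%N -> u \in s by rewrite -dvdn_divisors.
case/split_dvd => [/split_dvd[xm|[v -> vm]]|[v -> /split_dvd[vm|[w -> wm]]]].
- by rewrite inl.
- by rewrite map_f ?orbT// inl.
- by rewrite map_f ?orbT// inl.
- by rewrite !orbA orbC (map_f (fun u => p * (p * u)))%N// inl.
Qed.

(* Stated for every N >= n so that the induction can fix the range of summation. *)
Lemma size_divisors_sqr (N n : nat) : (0 < n <= N)%N ->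
  (size (divisors (n ^ 2)) <= 3 ^ (\sum_(0 <= p < N.+1 | prime p) logn p n))%N.
Proof.
elim/ltn_ind: n => n IH /andP[n0 nN].
have [->|n1] := eqVneq n 1%N; first by rewrite /= expn_gt0.
have pp : prime (pdiv n) by rewrite pdiv_prime//; lia.
have /dvdnP[m nE] := pdiv_dvd n; set p := pdiv n in pp nE.
have m0 : (0 < m)%N by move: n0; rewrite nE muln_gt0 => /andP[].
have mn : (m < n)%N by rewrite nE ltn_Pmulr// prime_gt1.
have pN : (p < N.+1)%N by rewrite ltnS (leq_trans _ nN)// pdiv_leq.
apply: (@leq_trans (3 * size (divisors (m ^ 2)))).
  have -> : (n ^ 2 = p * (p * m ^ 2))%N by rewrite nE; ring.
  by rewrite divisors_mul_prime_sqr// expn_gt0 m0.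
apply: (@leq_trans (3 * 3 ^ (\sum_(0 <= p < N.+1 | prime p) logn p m))).
  by rewrite leq_mul2l IH//= m0 (leq_trans (ltnW mn)).
rewrite -expnS leq_exp2l// nE.
under [leqRHS]eq_bigr do rewrite lognM ?(prime_gt0 pp)//.
rewrite big_split /= -addn1 leq_add2l.
rewrite big_mkcond (bigD1_seq p) ?mem_index_iota ?iota_uniq//=.
by rewrite pp logn_prime// eqxx.
Qed.

(** * Representations as divisors of a square *)

Lemma egyptian_pairsP (n a x y : nat) : (0 < n)%N -> (0 < x)%N -> (0 < y)%N ->
  egyptian_pairs n a (x, y) <-> (a * (x * y) = n * (x + y))%N.
Proof.
move=> n0 x0 y0.
have nz (k : nat) : (0 < k)%N -> (k%:R != 0 :> rat)%R by rewrite pnatr_eq0 -lt0n.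
have nn := nz _ n0; have nx := nz _ x0; have ny := nz _ y0.
have key : ((a%:R / n%:R = x%:R^-1 + y%:R^-1 :> rat) <->
    a%:R * (x%:R * y%:R) = n%:R * (x%:R + y%:R) :> rat)%R.
  split => [E|E].
    have -> : (a%:R = n%:R * (x%:R^-1 + y%:R^-1) :> rat)%R.
      by rewrite -E mulrCA mulfV // mulr1.
    by field; rewrite nx ny.
  have -> : (a%:R = n%:R * (x%:R + y%:R) / (x%:R * y%:R) :> rat)%R.
    by rewrite -E mulfK// mulf_neq0.
  by field; rewrite nx ny nn.
split => [[_ _ /key]|E].
  by rewrite /= -natrD -!natrM => /eqP; rewrite eqr_nat => /eqP.
by split => //=; apply/key; rewrite -natrD -!natrM E.
Qed.

(** The equation a x y = n (x + y) forces a x, a y > n and becomes (a x - n)(a y - n) = n^2. Hence a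
    x - n is a divisor of n^2, and it determines the pair. *)
Lemma num_egyptian_pairs_le (n a : nat) : (0 < n)%N -> (0 < a)%N ->
  (num_egyptian_pairs n a <= size (divisors (n ^ 2)))%N.
Proof.
move=> n0 a0; rewrite /num_egyptian_pairs.
have fin := finite_egyptian_pairs n0 a0.
set A := fset_set _.
have AP xy : xy \in A -> [/\ (0 < xy.1)%N, (0 < xy.2)%N &
    (a * (xy.1 * xy.2) = n * (xy.1 + xy.2))%N].
  rewrite in_fset_set// => /set_mem; case: xy => x y h; have [/= x0 y0 _] := h.
  by split => //; apply/egyptian_pairsP.
have key xy : xy \in A -> [/\ (n < a * xy.1)%N, (n < a * xy.2)%N &
    ((a * xy.1 - n) * (a * xy.2 - n) = n ^ 2)%N].
  move=> /AP; case: xy => x y /= [x0 y0 E].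
  have hx : (n < a * x)%N by nia.
  have hy : (n < a * y)%N by nia.
  by split => //; nia.
rewrite -(size_map (fun xy => (a * xy.1 - n)%N)); apply: uniq_leq_size.
  rewrite map_inj_in_uniq ?fset_uniq// => -[x y] [x' y'] xyA xyA' /= E.
  have [/= h1 h2 h3] := key _ xyA; have [/= h1' h2' h3'] := key _ xyA'.
  have xx : x = x' by apply/eqP; rewrite -(eqn_pmul2l a0); apply/eqP; lia.
  congr pair => //; apply/eqP; rewrite -(eqn_pmul2l a0); apply/eqP.
  have : ((a * x - n) * (a * y - n) = (a * x - n) * (a * y' - n))%N.
    by rewrite h3 E h3'.
  move=> /eqP; rewrite eqn_pmul2l ?subn_gt0//; lia.
move=> _ /mapP[xy xyA ->]; have [h1 h2 h3] := key _ xyA.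
by rewrite -dvdn_divisors ?expn_gt0 ?n0// -h3 dvdn_mulr.
Qed.

(* With d = gcd(n, a), a divisor u of (n / d)^2 in the class of - n / d modulo
   a / d yields the pair x = (u + n / d) / (a / d), y = (v + n / d) / (a / d),
   where u * v = (n / d)^2. *)
Lemma num_egyptian_pairs_ge (n a m : nat) :
  (0 < n)%N -> (0 < a)%N -> (m %| n)%N -> coprime m a ->
  exists2 c, coprime c a &
    (count (fun u => u == c %[mod a]) (divisors (m ^ 2)) <=
     num_egyptian_pairs n a)%N.
Proof.
move=> n0 a0 mn ma; set d := gcdn n a.
have d0 : (0 < d)%N by rewrite gcdn_gt0 n0.
have /dvdnP[n' nE] : (d %| n)%N := dvdn_gcdl n a.
have /dvdnP[a' aE] : (d %| a)%N := dvdn_gcdr n a.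
have n'0 : (0 < n')%N by move: n0; rewrite nE muln_gt0 => /andP[].
have a'0 : (0 < a')%N by move: a0; rewrite aE muln_gt0 => /andP[].
have cna : coprime n' a'.
  rewrite /coprime -(eqn_pmul2r d0) muln_gcdl -nE -aE mul1n.
  exact: eqxx.
have mn' : (m %| n')%N.
  rewrite -(@Gauss_dvdl _ _ d) -?nE//.
  by apply: coprime_dvdr ma; rewrite aE dvdn_mull.
have m0 : (0 < m)%N := dvdn_gt0 n0 mn.
(* [n' * a'.-1] represents - n' modulo [a'] without subtraction. It is a unit modulo [a']; adding a
   multiple of [a'] makes it a unit modulo [a]. *)
have [t ct] : exists t, coprime (n' * a'.-1 + a' * t) a.
  by apply: coprime_lift => //; rewrite coprimeMl cna; case: (a') a'0 => // k _;
    rewrite coprimenS.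
exists (n' * a'.-1 + a' * t)%N => //; set c := (n' * a'.-1 + a' * t)%N.
pose us := [seq u <- divisors (m ^ 2) | u == c %[mod a]].
pose f u := ((u + n') %/ a', (n' ^ 2 %/ u + n') %/ a')%N.
have usP u : u \in us -> [/\ (0 < u)%N, (u %| n' ^ 2)%N, (a' %| u + n')%N &
    (a' %| n' ^ 2 %/ u + n')%N].
  rewrite mem_filter -dvdn_divisors ?expn_gt0 ?m0// => /andP[/eqP uc um].
  have un : (u %| n' ^ 2)%N by apply: dvdn_trans um (dvdn_exp2r _ mn').
  have u0 : (0 < u)%N by apply: dvdn_gt0 un; rewrite expn_gt0 n'0.
  have h1 : (a' %| u + n')%N.
    have E : u = c %[mod a'].
      by rewrite -(@modn_dvdm a u a') ?uc ?modn_dvdm// aE dvdn_mulr.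
    rewrite /dvdn -modnDml E modnDml.
    have -> : (c + n' = a' * (n' + t))%N by rewrite /c addnAC -mulnSr prednK//; ring.
    by rewrite modnMr.
  split => //.
  (* A common prime of [u] and [a'] would divide [n'], against coprimality. So [u] can be cancelled
     in a' | u (v + n') = n' (u + n'), where u v = n'^2. *)
  have ua' : coprime u a'.
    apply: coprime_primeP => // p pp pu pa.
    have : (p %| n')%N by rewrite -(dvdn_addr _ pu); apply: dvdn_trans h1.
    move=> pn; have : (p %| gcdn n' a')%N by rewrite dvdn_gcd pn.
    by rewrite (eqP cna) Euclid_dvd1.
  rewrite -(@Gauss_dvdr _ u) 1?coprime_sym// mulnDr mulnC divnK//.
  have -> : (n' ^ 2 + u * n' = n' * (u + n'))%N by ring.
  exact: dvdn_mull.
rewrite -size_filter -/us -(size_map f) /num_egyptian_pairs.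
have fin := finite_egyptian_pairs n0 a0.
apply: uniq_leq_size.
  rewrite map_inj_in_uniq ?filter_uniq ?divisors_uniq// => u v uu vu [E _].
  have [_ _ du _] := usP _ uu; have [_ _ dv _] := usP _ vu.
  by apply/eqP; rewrite -(eqn_add2r n') -(divnK du) E divnK.
move=> _ /mapP[u uu ->]; rewrite in_fset_set// inE.
have [u0 /dvdnP[v vE] du dv] := usP _ uu.
move: dv; rewrite /f vE mulnK//.
case/dvdnP: du => x xE /dvdnP[y yE]; rewrite xE yE !mulnK//.
have x0 : (0 < x)%N by case: (x) xE => //; lia.
have y0 : (0 < y)%N by case: (y) yE => //; lia.
apply/egyptian_pairsP => //.
have E : (a' * (a' * (x * y)) = a' * (n' * (x + y)))%N.
  have -> : (a' * (a' * (x * y)) = (x * a') * (y * a'))%N by ring.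
  have -> : (a' * (n' * (x + y)) = n' * (x * a' + y * a'))%N by ring.
  rewrite -xE -yE; have -> : ((u + n') * (v + n') = v * u + n' * (u + v + n'))%N by ring.
  by rewrite -vE; ring.
move/eqP: E; rewrite eqn_pmul2l// => /eqP E.
rewrite nE aE; have -> : (a' * d * (x * y) = d * (a' * (x * y)))%N by ring.
by rewrite E; ring.
Qed.

(** * Sums over primes *)

Local Open Scope ring_scope.

Lemma sum_dvd (V : nmodType) (p N : nat) (G : nat -> V) : (0 < p)%N ->
  \sum_(1 <= n < N.+1 | (p %| n)%N) G n =
  \sum_(1 <= m < (N %/ p).+1) G (p * m)%N.
Proof.
move=> p0; rewrite -big_filter -(big_map (muln p) predT); apply: perm_big.
have ip : injective (muln p) by move=> x y /eqP; rewrite eqn_pmul2l// => /eqP.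
apply: uniq_perm; rewrite ?filter_uniq ?map_inj_uniq ?iota_uniq// => n.
rewrite mem_filter mem_index_iota ltnS; apply/andP/mapP => [[/dvdnP[m ->] /andP[m0 mN]]|].
  exists m; last by rewrite mulnC.
  rewrite mem_index_iota ltnS leq_divRL// mN andbT.
  by move: m0; rewrite muln_gt0 => /andP[].
move=> [m]; rewrite mem_index_iota ltnS leq_divRL// => /andP[m0 mN ->].
by rewrite dvdn_mulr// muln_gt0 p0 m0 mulnC mN.
Qed.

Section prime_sums.
Variable R : realType.
Implicit Types (F : pred nat) (g : nat -> R) (p N : nat) (ps : seq nat).

Lemma sum_multiples_le F g p N : (0 < p)%N ->
  (forall n, 0 <= g n) -> (forall m, g (p * m)%N = g p * g m) ->
  (forall m, F (p * m)%N -> F m) ->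
  \sum_(1 <= n < N.+1 | F n && (p %| n)%N) g n <=
  g p * \sum_(1 <= m < N.+1 | F m) g m.
Proof.
move=> p0 g0 gM FM; rewrite big_mkcondl sum_dvd// mulr_sumr.
have -> : \sum_(1 <= m < (N %/ p).+1) (if F (p * m)%N then g (p * m)%N else 0) =
    \sum_(1 <= m < (N %/ p).+1 | F (p * m)%N) g p * g m.
  by rewrite [RHS]big_mkcond; apply: eq_bigr => m _; rewrite gM.
rewrite [leRHS](big_cat_nat _ (n := (N %/ p).+1))//=; last by rewrite ltnS leq_div.
rewrite -[leLHS]addr0 lerD//; last by apply: sumr_ge0 => m _; rewrite mulr_ge0.
rewrite big_mkcond [leRHS]big_mkcond; apply: ler_sum => m _.
by case: ifP => [/FM ->//|_]; case: ifP => // _; rewrite mulr_ge0.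
Qed.

Lemma ln_le_harmonic N : ln N.+1%:R <= \sum_(1 <= n < N.+1) n%:R^-1 :> R.
Proof.
elim: N => [|N IH]; first by rewrite big_geq// ln1.
rewrite big_nat_recr//=; apply: le_trans (lerD IH (lexx _)).
have -> : N.+2%:R = N.+1%:R * (1 + N.+1%:R^-1) :> R.
  by rewrite mulrDr mulr1 mulfV ?pnatr_eq0// -natr1.
rewrite lnM ?posrE ?addr_gt0 ?invr_gt0 ?ltr0n// lerD2l le_ln1Dx//.
by apply: (@lt_le_trans _ _ 0); rewrite ?ltrN10// invr_ge0 ler0n.
Qed.

(** Truncated Euler product, with factors (1 - 1/p)^-1 = 1 + 1/(p - 1) <= exp(1/(p - 1)). Splitting
    off the multiples of [p] gives S <= S' + S / p, which is solved for S. *)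
Lemma harmonic_smooth_le ps N : all prime ps ->
  \sum_(1 <= n < N.+1 | all (mem ps) (primes n)) n%:R^-1 <=
  expR (\sum_(p <- ps) p.-1%:R^-1) :> R.
Proof.
elim: ps => [_|p ps IH /= /andP[pp aps]].
  rewrite big_nil expR0 big_mkcond /=.
  case: N => [|N]; first by rewrite big_geq.
  rewrite big_nat_recl//= invr1 big1_seq ?addr0// => i /andP[_].
  rewrite mem_index_iota => /andP[i1 _]; case: ifP => // /allP h.
  have : pdiv i.+1 \in primes i.+1 by rewrite mem_primes pdiv_prime// pdiv_dvd.
  by move=> /h.
set S := leLHS; set S' := \sum_(1 <= n < N.+1 | all (mem ps) (primes n)) n%:R^-1 in IH.
have p1 : 1 < p%:R :> R by rewrite ltr1n prime_gt1.
have p0 : 0 < p%:R :> R by apply: lt_trans p1.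
have : S <= S' + p%:R^-1 * S.
  rewrite {1}/S (bigID (dvdn p)) /= addrC lerD//; last first.
    apply: (@sum_multiples_le (fun n => all (mem (p :: ps)) (primes n))) => //.
    - exact: prime_gt0.
    - by move=> n; rewrite natrM invfM.
    - move=> [|m]; first by [].
      move=> /allP h; apply/allP => q qm; apply: h.
      by rewrite primesM ?(prime_gt0 pp)// qm orbT.
  rewrite big_mkcond /S' [leRHS]big_mkcond; apply: ler_sum => n _ /=.
  case: ifP => [/andP[/allP h pn]|_]; last by case: ifP.
  case: ifP => // /negP[]; apply/allP => q qn; have := h _ qn; rewrite !inE => /orP[/eqP qp|//].
  by move: qn pn; rewrite qp mem_primes => /and3P[_ _ ->].
have E : p.-1%:R = p%:R - 1 :> R by rewrite -subn1 natrB// prime_gt0.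
move=> hS; have {}hS : S <= (1 + p.-1%:R^-1) * S'.
  have -> : 1 + p.-1%:R^-1 = (1 - p%:R^-1)^-1 :> R.
    by rewrite E; field; rewrite !subr_eq0 !gt_eqF.
  rewrite ler_pdivlMl; first by rewrite mulrBl mul1r lerBlDr.
  by rewrite subr_gt0 invf_lt1.
apply: le_trans hS _; rewrite big_cons expRD; apply: ler_pM.
- by rewrite addr_ge0// invr_ge0.
- by apply: sumr_ge0 => n _; rewrite invr_ge0.
- exact: expR_ge1Dx.
- exact: IH.
Qed.

Definition prime_recip (P : pred nat) (z : nat) : R :=
  \sum_(0 <= p < z.+1 | prime p && P p) p%:R^-1.

(** The terms are 1/(p (p - 1)); taken over all integers from 2 on, they telescope. *)
Lemma sum_prime_telescope N :
  \sum_(0 <= p < N.+1 | prime p) (p.-1%:R^-1 - p%:R^-1) <= 1 :> R.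
Proof.
case: N => [|N]; first by rewrite big_mkcond big_nat1 ler01.
suff : \sum_(0 <= p < N.+2 | prime p) (p.-1%:R^-1 - p%:R^-1) <= 1 - N.+1%:R^-1 :> R.
  by move=> /le_trans; apply; rewrite lerBlDr lerDl invr_ge0.
elim: N => [|N IH].
  by rewrite big_mkcond /= big_nat_recr//= big_nat1/= addr0 invr1 subrr.
rewrite big_mkcond big_nat_recr//= -big_mkcond /=.
have -> : 1 - N.+2%:R^-1 = (1 - N.+1%:R^-1) + (N.+1%:R^-1 - N.+2%:R^-1) :> R by ring.
rewrite lerD//; case: ifP => // _.
by rewrite subr_ge0 lef_pV2 ?posrE ?ltr0n// ler_nat.
Qed.

(** Every n <= N is composed of primes p <= N, so ln N is at most the exponential of the sum of 1/(p
    - 1). Passing from 1/(p - 1) to 1/p costs at most 1. *)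
Lemma prime_recip_ge N : (2 < N)%N -> ln (ln N%:R) - 1 <= prime_recip predT N.
Proof.
move=> N2; have N0 : 1 < N%:R :> R by rewrite ltr1n; lia.
have lN : 0 < ln N%:R :> R by rewrite ln_gt0.
set s : R := \sum_(0 <= p < N.+1 | prime p) p.-1%:R^-1.
have h : ln N%:R <= expR s.
  apply: (@le_trans _ _ (ln N.+1%:R)).
    by rewrite ler_ln ?posrE ?ltr0n ?ler_nat//; lia.
  apply: le_trans (ln_le_harmonic N) _.
  pose ps := [seq p <- index_iota 0 N.+1 | prime p].
  have aps : all prime ps by apply/allP => p; rewrite mem_filter => /andP[].
  have -> : s = \sum_(p <- ps) p.-1%:R^-1 by rewrite big_filter.
  apply: le_trans (@harmonic_smooth_le ps N aps).
  rewrite [leRHS]big_mkcond /=; rewrite big_nat [leRHS]big_nat; apply: ler_sum => n /andP[n1 nN].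
  rewrite ifT//; apply/allP => p; rewrite mem_primes => /and3P[pp n0 pn].
  by rewrite inE /= mem_filter pp mem_index_iota /= (leq_ltn_trans (dvdn_leq n0 pn)).
rewrite lerBlDr; apply: (@le_trans _ _ s).
  by rewrite -(expRK s) ler_ln ?posrE ?expR_gt0.
rewrite -lerBlDl /prime_recip; under [X in _ - X]eq_bigl do rewrite andbT.
by rewrite /s -sumrB sum_prime_telescope.
Qed.

(** * Upper bound for the sum of 1/p through zeta near 1 *)

Section zeta.
Variable t : R.
Hypothesis t_gt0 : 0 < t.

Definition zeta_term (n : nat) : R := expR (- (1 + t) * ln n%:R).

Lemma zeta_termM m n : (0 < m)%N -> (0 < n)%N ->
  zeta_term (m * n) = zeta_term m * zeta_term n.
Proof.
by move=> m0 n0; rewrite /zeta_term natrM lnM ?posrE ?ltr0n// mulrDr expRD.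
Qed.

Lemma sum_zeta_term_le M : \sum_(1 <= n < M.+1) zeta_term n <= 1 + t^-1.
Proof.
case: M => [|M].
  by rewrite big_geq// addr_ge0// invr_ge0 ltW.
(* The fraction is the integral of x^(-1-t) from 1 to M + 1; this sharper bound makes the induction
   work. *)
suff : \sum_(1 <= n < M.+2) zeta_term n <=
    1 + (1 - expR (- t * ln M.+1%:R)) / t.
  by move=> /le_trans; apply; rewrite lerD2l ler_pdivrMr// mulVf ?gt_eqF.
elim: M => [|M IH].
  by rewrite big_nat1 /zeta_term ln1 !mulr0 expR0 subrr mul0r addr0.
rewrite big_nat_recr//=; apply: le_trans (lerD IH (lexx _)) _.
rewrite -addrA lerD2l; set A := ln M.+1%:R; set B := ln M.+2%:R.
have AB : M.+2%:R^-1 <= B - A :> R.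
  have -> : B - A = - ln (1 - M.+2%:R^-1).
    have -> : 1 - M.+2%:R^-1 = M.+1%:R / M.+2%:R :> R.
      have y0 : M.+2%:R != 0 :> R by rewrite pnatr_eq0.
      by apply: (mulIf y0); rewrite mulrBl mul1r mulVf// divfK// -natr1 addrK.
    by rewrite ln_div ?posrE ?ltr0n// opprB.
  rewrite lerNr le_ln1Dx// ltrN2 invf_lt1 ?ltr0n// ltr1n.
  by [].
have gE : zeta_term M.+2 = expR (- t * B) * M.+2%:R^-1.
  rewrite /zeta_term -/B mulNr mulrDl mul1r opprD addrC expRD mulNr; congr (_ * _).
  by rewrite expRN lnK// posrE ltr0n.
(* With n = M + 2 this is t n^(-1-t) <= (n - 1)^(-t) - n^(-t), from exp x >= 1 + x at x = t (B -
   A). *)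
have key : t * zeta_term M.+2 <= expR (- t * A) - expR (- t * B).
  have -> : expR (- t * A) = expR (- t * B) * expR (t * (B - A)).
    by rewrite -expRD; congr expR; ring.
  rewrite -[X in _ - X]mulr1 -mulrBr gE mulrCA ler_pM2l ?expR_gt0//.
  rewrite lerBrDl; apply: le_trans (expR_ge1Dx _).
  by rewrite lerD2l ler_pM2l.
rewrite -lerBrDl -mulrBl ler_pdivlMr// mulrC; apply: le_trans key _.
by lra.
Qed.

Definition sifted_zeta ps M : R :=
  \sum_(1 <= n < M.+1 | all (fun p => ~~ (p %| n)%N) ps) zeta_term n.

(** Each sifted n <= M gives two terms on the right: n itself, not divisible by [p], and p n <= p
    M. *)
Lemma sifted_zeta_step p ps M : prime p -> p \notin ps -> all prime ps ->
  (1 + zeta_term p) * sifted_zeta (p :: ps) M <= sifted_zeta ps (p * M).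
Proof.
move=> pp pps aps; have p0 := prime_gt0 pp.
rewrite mulrDl mul1r {3}/sifted_zeta [leRHS](bigID (dvdn p)) /= [leLHS]addrC lerD//.
  rewrite [leRHS]big_mkcondl sum_dvd// mulKn// /sifted_zeta mulr_sumr.
  rewrite big_mkcond big_nat [leRHS]big_nat; apply: ler_sum => m /andP[m0 _].
  case: ifP => [/andP[_ /allP h]|_]; last by case: ifP => // _; exact: expR_ge0.
  rewrite ifT ?zeta_termM//; apply/allP => q qps.
  have qp := allP aps _ qps.
  rewrite Euclid_dvdM// negb_or (h _ qps) andbT dvdn_prime2//.
  by apply: contraNneq pps => <-.
rewrite /sifted_zeta [leRHS](big_cat_nat _ (n := M.+1))//=; last first.
  by rewrite ltnS leq_pmull.
rewrite -[leLHS]addr0 lerD//; last by apply: sumr_ge0 => m _; exact: expR_ge0.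
by under eq_bigl do rewrite andbC.
Qed.

(** Iterating the sifting step from the one-term sum at M = 1 bounds the product over [ps] by a
    finite partial sum of zeta. *)
Lemma prod_zeta_le ps : uniq ps -> all prime ps ->
  \prod_(p <- ps) (1 + zeta_term p) <= 1 + t^-1.
Proof.
move=> ups aps.
suff h M : uniq ps -> all prime ps -> \prod_(p <- ps) (1 + zeta_term p) * sifted_zeta ps M <=
    sifted_zeta [::] (M * \prod_(p <- ps) p).
  have s1 : sifted_zeta ps 1 = 1.
    rewrite /sifted_zeta big_mkcond big_nat1 ifT.
      by rewrite /zeta_term ln1 mulr0 expR0.
    apply/allP => p /(allP aps) pp.
    by rewrite dvdn1; apply: contraTneq pp => ->.
  by have := le_trans (h 1%N ups aps) (sum_zeta_term_le _); rewrite s1 mulr1.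
elim: ps M {ups aps} => [|p ps IH] M.
  by move=> _ _; rewrite !big_nil mul1r muln1.
move=> /= /andP[pps ups] /andP[pp aps].
rewrite !big_cons mulrC mulrA mulnA.
have g1 q : 0 <= 1 + zeta_term q by rewrite addr_ge0// expR_ge0.
apply: le_trans (IH (M * p)%N ups aps).
rewrite mulrC ler_wpM2l//; first by apply: prodr_ge0.
by rewrite mulrC [(M * p)%N]mulnC sifted_zeta_step.
Qed.

(** Taking logarithms needs exp(x - x^2) <= 1 + x, which holds because x - x^2 <= x / (1 + x) <= ln
    (1 + x). *)
Lemma sum_prime_zeta_le ps : uniq ps -> all prime ps ->
  \sum_(p <- ps) (zeta_term p - zeta_term p ^+ 2) <= ln (1 + t^-1).
Proof.
move=> ups aps.
rewrite -ler_expR lnK ?posrE ?addr_gt0 ?invr_gt0//.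
apply: le_trans (prod_zeta_le ups aps).
rewrite expR_sum; apply: ler_prod => p _; rewrite expR_ge0 /=.
set x := zeta_term p; have x0 : 0 < x by exact: expR_gt0.
have x1 : 0 < 1 + x by rewrite addr_gt0.
have : 1 - x / (1 + x) <= expR (- (x / (1 + x))) by exact: expR_ge1Dx.
have -> : 1 - x / (1 + x) = (1 + x)^-1 by field; rewrite gt_eqF.
rewrite expRN lef_pV2 ?posrE ?expR_gt0//; apply: le_trans.
rewrite ler_expR ler_pdivlMr//.
have -> : (x - x ^+ 2) * (1 + x) = x - x ^+ 3 by ring.
by rewrite lerBlDr lerDl exprn_ge0// ltW.
Qed.

End zeta.

(* For p <= N the weight p^(-1-t) with t = d / ln N is at least exp(-d) / p,
   which transfers the bound at exponent 1 + t to exponent 1. *)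
Lemma prime_recip_le (d : R) N : 0 < d <= 1 -> 1 <= ln (N%:R : R) ->
  prime_recip predT N <= expR d * (ln (ln N%:R) + ln (2 / d) + 1).
Proof.
move=> /andP[d0 d1] lN; have lN0 : 0 < ln N%:R :> R by apply: lt_le_trans lN.
pose t := d / ln N%:R; have t0 : 0 < t by rewrite divr_gt0.
pose ps := [seq p <- index_iota 0 N.+1 | prime p].
have ups : uniq ps by rewrite filter_uniq// iota_uniq.
have aps : all prime ps by apply/allP => p; rewrite mem_filter => /andP[].
have psN p : p \in ps -> prime p /\ (p <= N)%N.
  by rewrite mem_filter mem_index_iota ltnS => /andP[].
have h := sum_prime_zeta_le t0 ups aps.
(* 1 + 1/t <= 2 ln N / d, because 1/t = ln N / d >= 1. *)
have hl : ln (1 + t^-1) <= ln (ln N%:R) + ln (2 / d).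
  rewrite -lnM ?posrE ?divr_gt0// ler_ln ?posrE ?mulr_gt0 ?divr_gt0 ?addr_gt0 ?invr_gt0//.
  have -> : t^-1 = ln N%:R / d by rewrite /t invfM invrK mulrC.
  have : 1 <= ln N%:R / d by rewrite ler_pdivlMr// mul1r (le_trans d1).
  by rewrite [2 / d]mulrC mulrA; lra.
(* The squares p^(-2-2t) are at most 1/p^2 <= 1/(p (p - 1)), which telescopes. *)
have h2 : \sum_(p <- ps) zeta_term t p ^+ 2 <= 1.
  apply: le_trans (sum_prime_telescope N); rewrite -[leRHS]big_filter -/ps.
  rewrite big_seq [leRHS]big_seq; apply: ler_sum => p /psN[pp pN].
  have p0 : 0 < p%:R :> R by rewrite ltr0n prime_gt0.
  have p1 : 1 < p%:R :> R by rewrite ltr1n prime_gt1.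
  have E : p.-1%:R = p%:R - 1 :> R by rewrite -subn1 natrB// prime_gt0.
  have zp : zeta_term t p <= p%:R^-1.
    rewrite -[leRHS]lnK ?posrE ?invr_gt0// ler_expR lnV ?posrE// mulNr lerN2.
    by rewrite mulrDl mul1r lerDl mulr_ge0 ?ltW// ln_gt0.
  apply: (@le_trans _ _ (p%:R^-1 ^+ 2)).
    by rewrite lerXn2r// nnegrE ?invr_ge0//; exact: expR_ge0.
  have -> : p.-1%:R^-1 - p%:R^-1 = (p%:R * (p%:R - 1))^-1 :> R.
    by rewrite E; field; rewrite subr_eq0 !gt_eqF.
  rewrite expr2 -invfM lef_pV2 ?posrE ?mulr_gt0 ?subr_gt0//.
  by rewrite ler_pM2l// gerBl.
have -> : prime_recip predT N = \sum_(p <- ps) p%:R^-1 :> R.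
  by rewrite big_filter /prime_recip; apply: eq_bigl => p; rewrite andbT.
have h1 : \sum_(p <- ps) p%:R^-1 <= expR d * \sum_(p <- ps) zeta_term t p :> R.
  rewrite mulr_sumr big_seq [leRHS]big_seq; apply: ler_sum => p /psN[pp pN].
  have p0 : 0 < p%:R :> R by rewrite ltr0n prime_gt0.
  rewrite -[leLHS]lnK ?posrE ?invr_gt0// -expRD ler_expR lnV ?posrE//.
  have : t * ln p%:R <= d.
    rewrite /t -mulrA -[leRHS]mulr1 ler_pM2l// ler_pdivrMl// mulr1.
    by rewrite ler_ln ?posrE ?ler_nat// ltr0n (leq_trans (prime_gt0 pp)).
  lra.
apply: le_trans h1 _; rewrite ler_pM2l ?expR_gt0//.
move: h; rewrite sumrB; lra.
Qed.

(** * Concentration of the number of prime factors *)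

Lemma markov_count (s : seq nat) (f : nat -> R) (l : R) :
  (forall n, 0 <= f n) ->
  l * (count (fun n => l <= f n) s)%:R <= \sum_(n <- s) f n.
Proof.
move=> f0; rewrite -sum1_count natr_sum mulr_sumr big_mkcond /=.
by apply: ler_sum => n _; case: ifP; rewrite ?mulr1.
Qed.

Lemma sum_dvdn_natr p N : (0 < p)%N ->
  (N%:R / p%:R - 1 : R) <= \sum_(1 <= n < N.+1) ((p %| n)%N%:R : R) <=
  N%:R / p%:R.
Proof.
move=> p0; have p0' : 0 < p%:R :> R by rewrite ltr0n.
rewrite -natr_sum -divn_count_dvd ler_pdivlMr// -natrM ler_nat leq_divM andbT.
rewrite lerBlDr ler_pdivrMr// natr1 -natrM ler_nat ltnW// mulnC.
by rewrite {1}(divn_eq N p) mulnS addnC mulnC ltn_add2r ltn_mod.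
Qed.

Definition omega_in (P : pred nat) z n : nat :=
  (\sum_(0 <= p < z.+1 | prime p && P p) (p %| n))%N.

Lemma prime_recip_ge0 P z : 0 <= prime_recip P z.
Proof. by apply: sumr_ge0 => p _; rewrite invr_ge0. Qed.

(** Expand the square. The first moment is at least N E - z, with an error of at most 1 for each p
    <= z. The second is at most N E^2 + N E: distinct primes give at most N / (p q), the diagonal at
    most N / p. The terms N E^2 cancel. *)
Lemma turan_kubilius (P : pred nat) z N :
  \sum_(1 <= n < N.+1) ((omega_in P z n)%:R - prime_recip P z) ^+ 2 <=
  N%:R * prime_recip P z + 2 * prime_recip P z * z%:R.
Proof.
set E := prime_recip P z; have E0 : 0 <= E := prime_recip_ge0 P z.
pose w n : R := (omega_in P z n)%:R.
have wE n : w n = \sum_(0 <= p < z.+1 | prime p && P p) (p %| n)%N%:R.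
  by rewrite /w natr_sum.
have S1 : N%:R * E - z%:R <= \sum_(1 <= n < N.+1) w n.
  under eq_bigr do rewrite wE.
  rewrite exchange_big /=.
  apply: (@le_trans _ _ (\sum_(0 <= p < z.+1 | prime p && P p) (N%:R / p%:R - 1))).
    rewrite sumrB -mulr_sumr -/E lerD2l lerN2.
    rewrite big_mkcond big_nat_recl//= add0r.
    have -> : z%:R = \sum_(0 <= i < z) 1 :> R by rewrite sumr_const_nat subn0.
    by apply: ler_sum => i _; case: ifP.
  apply: ler_sum => p /andP[pp _].
  by have /andP[] := sum_dvdn_natr N (prime_gt0 pp).
have S2 : \sum_(1 <= n < N.+1) w n ^+ 2 <= N%:R * E ^+ 2 + N%:R * E.
  pose T p q : R := N%:R / p%:R / q%:R + (if q == p then N%:R / p%:R else 0).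
  apply: (@le_trans _ _ (\sum_(0 <= p < z.+1 | prime p && P p)
      \sum_(0 <= q < z.+1 | prime q && P q) T p q)); last first.
    under eq_bigr do rewrite big_split /= -mulr_sumr -/E.
    rewrite big_split /= -mulr_suml -mulr_sumr -/E -mulrA -expr2 lerD2l.
    rewrite /E /prime_recip mulr_sumr big_nat_cond [leRHS]big_nat_cond.
    apply: ler_sum => p /andP[pz pP].
    rewrite big_mkcond (bigD1_seq p) ?mem_index_iota ?iota_uniq//= pP eqxx.
    rewrite big1 ?addr0// => q /negPf ->; by case: ifP.
  under eq_bigr do rewrite wE expr2 mulr_suml.
  rewrite exchange_big; apply: ler_sum => p /andP[pp _].
  under eq_bigr do rewrite mulr_sumr.
  rewrite exchange_big; apply: ler_sum => q /andP[qp _].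
  have p0 := prime_gt0 pp; have q0 := prime_gt0 qp.
  rewrite /T; case: eqVneq => [->|qNp].
    under eq_bigr do rewrite -natrM mulnb andbb.
    have /andP[_ h] := sum_dvdn_natr N p0.
    by apply: le_trans h _; rewrite lerDr !mulr_ge0 ?invr_ge0.
  have cpq : coprime p q by rewrite prime_coprime// dvdn_prime2// eq_sym.
  under eq_bigr do rewrite -natrM mulnb -Gauss_dvd//.
  have pq0 : (0 < p * q)%N by rewrite muln_gt0 p0.
  have /andP[_ h] := sum_dvdn_natr N pq0.
  by rewrite addr0 -mulrA -invfM -natrM.
have -> : \sum_(1 <= n < N.+1) (w n - E) ^+ 2 =
    \sum_(1 <= n < N.+1) w n ^+ 2 - 2 * E * (\sum_(1 <= n < N.+1) w n) + N%:R * E ^+ 2.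
  under eq_bigr do rewrite sqrrB.
  rewrite big_split /= sumrB sumr_const_nat subn1 /= [N%:R * _]mulr_natl mulr_sumr; congr (_ - _ + _).
  by apply: eq_bigr => n _; rewrite -mulr_natl; ring.
have := ler_wpM2l E0 S1; rewrite mulrBr => h.
by nra.
Qed.

Lemma turan_count (P : pred nat) z N (l : R) : 0 < l -> (z <= N)%N ->
  (count (fun n => l <= `|(omega_in P z n)%:R - prime_recip P z|)
     (index_iota 1 N.+1))%:R <= 3 * N%:R * prime_recip P z / l ^+ 2.
Proof.
move=> l0 zN; rewrite ler_pdivlMr ?exprn_gt0// mulrC.
set E := prime_recip P z; have E0 : 0 <= E := prime_recip_ge0 P z.
have := @markov_count (index_iota 1 N.+1)
  (fun n => ((omega_in P z n)%:R - E) ^+ 2) (l ^+ 2) (fun n => sqr_ge0 _).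
have -> : count (fun n => l ^+ 2 <= ((omega_in P z n)%:R - E) ^+ 2) (index_iota 1 N.+1) =
    count (fun n => l <= `|(omega_in P z n)%:R - E|) (index_iota 1 N.+1).
  apply: eq_count => n /=; rewrite -[X in _ <= X]real_normK ?num_real//.
  by rewrite ler_sqr ?nnegrE ?(ltW l0)//.
move=> /le_trans; apply; apply: le_trans (turan_kubilius P z N) _.
have zN' : z%:R <= N%:R :> R by rewrite ler_nat.
by have := ler_wpM2l E0 zN'; rewrite -/E; lra.
Qed.

(* For n <= N this is Omega(n) - omega(n). *)
Definition omega_excess N n : nat :=
  (\sum_(0 <= p < N.+1 | prime p) \sum_(2 <= k < N.+1) (p ^ k %| n))%N.

Lemma sum_logn_le N n : (0 < n <= N)%N ->
  (\sum_(0 <= p < N.+1 | prime p) logn p n <= omega_in predT N n + omega_excess N n)%N.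
Proof.
move=> /andP[n0 nN]; rewrite /omega_in /omega_excess.
under [X in (_ <= X + _)%N]eq_bigl do rewrite andbT.
rewrite -big_split /=; apply: leq_sum => p pp.
rewrite logn_count_dvd//.
apply: (@leq_trans (\sum_(1 <= k < N.+1) (p ^ k %| n))%N).
  by rewrite [leqRHS](big_cat_nat _ (n := n))//= ?leq_addr// ltnW.
by rewrite big_ltn ?expn1// ltnS (leq_trans n0).
Qed.

Lemma sum_geometric_le p K : (1 < p)%N ->
  \sum_(2 <= k < K.+2) (p ^ k)%N%:R^-1 <= p.-1%:R^-1 - p%:R^-1 :> R.
Proof.
move=> p1; have p1' : 1 < p%:R :> R by rewrite ltr1n.
have p0 : 0 < p%:R :> R by apply: lt_trans p1'.
have E : p.-1%:R = p%:R - 1 :> R by rewrite -subn1 natrB// ltnW.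
suff -> : \sum_(2 <= k < K.+2) (p ^ k)%N%:R^-1 =
    p.-1%:R^-1 - p%:R^-1 - (p ^ K.+1)%N%:R^-1 / p.-1%:R :> R.
  by rewrite lerBlDr lerDl divr_ge0.
have pn0 : p%:R != 0 :> R by rewrite gt_eqF.
have pn1 : p%:R - 1 != 0 :> R by rewrite subr_eq0 gt_eqF.
elim: K => [|K IH]; first by rewrite big_geq// expn1 E; field; rewrite pn0 pn1.
rewrite big_nat_recr//= IH E !(expnS p) !natrM.
have : (p ^ K)%N%:R != 0 :> R by rewrite natrX expf_neq0.
move: ((p ^ K)%N%:R : R) (p%:R : R) pn0 pn1 => x y y0 y1 x0.
by field; rewrite x0 y0 y1.
Qed.

(** The powers p^k with k >= 2 contribute at most N / (p (p - 1)) for each p, and these sum to at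
    most N. *)
Lemma sum_omega_excess_le N :
  \sum_(1 <= n < N.+1) (omega_excess N n)%:R <= N%:R :> R.
Proof.
rewrite -[leRHS]mulr1; apply: le_trans (ler_wpM2l _ (sum_prime_telescope N)) => //.
under eq_bigr do rewrite natr_sum.
rewrite exchange_big mulr_sumr; apply: ler_sum => p pp.
under eq_bigr do rewrite natr_sum.
rewrite exchange_big /=.
case: N => [|N]; first by rewrite mul0r big_geq.
apply: (@le_trans _ _ (N.+1%:R * \sum_(2 <= k < N.+2) (p ^ k)%N%:R^-1)).
  rewrite mulr_sumr; apply: ler_sum => k _.
  have pk0 : (0 < p ^ k)%N by rewrite expn_gt0 prime_gt0.
  by have /andP[] := sum_dvdn_natr N.+1 pk0.
by rewrite ler_wpM2l// sum_geometric_le// prime_gt1.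
Qed.

Lemma count_omega_excess N (T : R) : 0 < T ->
  (count (fun n => T <= (omega_excess N n)%:R) (index_iota 1 N.+1))%:R <= N%:R / T.
Proof.
move=> T0; rewrite ler_pdivlMr// mulrC.
apply: le_trans (sum_omega_excess_le N).
exact: (@markov_count _ (fun n => (omega_excess N n)%:R)).
Qed.

(** * Primes outside a proper submonoid of residues *)

Lemma submonoid_prime_divisors (h : pred nat) n : h 1%N ->
  (forall m k, h m -> h k -> h (m * k)%N) ->
  (0 < n)%N -> (forall p, prime p -> (p %| n)%N -> h p) -> h n.
Proof.
move=> h1 hM; elim/ltn_ind: n => n IH n0 hn.
have [->//|n1] := eqVneq n 1%N.
have pp : prime (pdiv n) by rewrite pdiv_prime//; lia.
have /dvdnP[m nE] := pdiv_dvd n; set p := pdiv n in pp nE.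
have m0 : (0 < m)%N by move: n0; rewrite nE muln_gt0 => /andP[].
rewrite nE; apply: hM; last by rewrite hn// nE dvdn_mull.
apply: IH => //; first by rewrite nE ltn_Pmulr// prime_gt1.
by move=> q qp qm; rewrite hn// nE dvdn_mulr.
Qed.

(* Multiplication by r maps the units inside the submonoid injectively to units
   outside of it: the inverse of a unit w modulo a is a power of w. *)
Lemma count_units_submonoid (a M r : nat) (h : pred nat) :
  h 1%N -> (forall m n, h m -> h n -> h (m * n)%N) ->
  (forall m n, m = n %[mod a] -> h m = h n) ->
  (0 < M)%N -> (a %| M)%N -> coprime r M -> ~~ h r ->
  (count (fun w => coprime w M && h w) (iota 0 M) <=
   count (fun w => coprime w M && ~~ h w) (iota 0 M))%N.
Proof.
move=> h1 hM hmod M0 aM rM hr.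
have a0 : (0 < a)%N := dvdn_gt0 M0 aM.
have [r' _ rr'] := coprime_mod_solve M0 rM (coprime1n M).
rewrite -!size_filter -(size_map (fun w => (w * r) %% M)%N); apply: uniq_leq_size.
  rewrite map_inj_in_uniq ?filter_uniq ?iota_uniq// => w v.
  rewrite !mem_filter !mem_iota /= add0n => /andP[_ wM] /andP[_ vM] E.
  have inv u : (u < M)%N -> (u * r %% M * r' %% M = u)%N.
    by move=> uM; rewrite modnMml -mulnA -modnMmr rr' modnMmr muln1 modn_small.
  by rewrite -(inv w)// E inv.
move=> _ /mapP[w + ->]; rewrite !mem_filter !mem_iota /= => /andP[/andP[wM hw] _].
rewrite ltn_pmod// andbT coprime_modl coprimeMl wM rM /=.
rewrite (hmod _ (w * r)%N) ?modn_dvdm//; apply: contra hr => hwr.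
have hX k : h (w ^ k)%N by elim: k => // k IH; rewrite expnS hM.
have := hM _ _ (hX (totient a).-1) hwr; rewrite (hmod _ r)//.
rewrite mulnA -expnSr prednK ?totient_gt0// -modnMml Euler_exp_totient.
  by rewrite modnMml mul1n.
exact: coprime_dvdr wM.
Qed.

(** For k >= 1 the block [M k, M (k + 1)) holds [count Q (iota 0 M)] points, each with 1/n between
    1/(M (k + 1)) and twice that. The block at k = 0 is left out, as the factor 2 fails there. *)
Lemma harmonic_period_bounds (M K : nat) (Q : pred nat) : (0 < M)%N ->
  (forall n, Q (n + M)%N = Q n) ->
  let X : R := \sum_(M <= n < M * K.+1 | Q n) n%:R^-1 in
  let D : R := (count Q (iota 0 M))%:R / M%:R * \sum_(1 <= k < K.+1) k.+1%:R^-1 in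
  D <= X <= 2 * D.
Proof.
move=> M0 QM /=.
have M0' : 0 < M%:R :> R by rewrite ltr0n.
have Qk k n : Q (n + M * k)%N = Q n.
  by elim: k => [|k IH]; rewrite ?muln0 ?addn0// mulnS [(M + _)%N]addnC addnA QM.
set C : R := (count Q (iota 0 M))%:R.
have CE x : C * x = \sum_(0 <= i < M | Q i) x.
  by rewrite /C -sum1_count natr_sum mulr_suml /index_iota subn0; under eq_bigr do rewrite mul1r.
elim: K => [|K /andP[IH1 IH2]]; first by rewrite muln1 !big_geq// !mulr0 lexx.
rewrite big_nat_recr//= [\sum_(M <= n < _ | _) _](big_cat_nat _ (n := (M * K.+1)%N))/=; last 2 first.
- by rewrite leq_pmulr.
- by rewrite leq_mul2l leqnSn orbT.
set B := \sum_((M * K.+1)%N <= n < (M * K.+2)%N | Q n) n%:R^-1.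
have BE : B = \sum_(0 <= i < M | Q i) (i + M * K.+1)%N%:R^-1.
  rewrite /B -{1}(add0n (M * K.+1)%N) big_addn mulnS addnK.
  by apply: eq_bigl => i; rewrite Qk.
have B1 : C / M%:R * K.+2%:R^-1 <= B.
  rewrite -mulrA -invfM -natrM BE CE big_nat_cond [leRHS]big_nat_cond.
  apply: ler_sum => i /andP[/andP[_ iM] _].
  rewrite lef_pV2 ?posrE ?ltr0n ?ler_nat ?addn_gt0 ?muln_gt0 ?M0 ?orbT//.
  by rewrite [(M * K.+2)%N]mulnS leq_add2r ltnW.
have B2 : B <= 2 * (C / M%:R * K.+2%:R^-1).
  have -> : 2 * (C / M%:R * K.+2%:R^-1) = C * (2 / (M%:R * K.+2%:R)).
    by rewrite invfM; ring.
  rewrite BE CE big_nat_cond [leRHS]big_nat_cond.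
  apply: ler_sum => i /andP[/andP[_ iM] _].
  rewrite -[leLHS]mul1r ler_pdivrMr ?ltr0n ?addn_gt0 ?muln_gt0 ?M0 ?orbT//.
  rewrite mulrAC ler_pdivlMr ?mulr_gt0// mul1r -natrM -natrM ler_nat.
  by rewrite mulnDr !mulnS; nia.
by rewrite !mulrDr lerD//= lerD.
Qed.

(** If the sum were bounded, its tail beyond some z would be at most 1/8. An n prime to M and
    outside the submonoid has a prime factor p > z outside it, so such n carry at most 1/8 of the
    harmonic weight of the n prime to M. They fill at least half of the reduced classes, a
    contradiction on long ranges. *)
Lemma prime_recip_unbounded (a c : nat) (h : pred nat) :
  h 1%N -> (forall m n, h m -> h n -> h (m * n)%N) ->
  (forall m n, m = n %[mod a] -> h m = h n) ->
  (0 < a)%N -> coprime c a -> ~~ h c ->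
  forall B, exists z, B < prime_recip [pred p | coprime p a && ~~ h p] z.
Proof.
move=> h1 hM hmod a0 ca hc B; apply: contrapT => hB.
pose P := [pred p | coprime p a && ~~ h p]; pose e z := prime_recip P z.
have eB z : e z <= B.
  by rewrite leNgt; apply/negP => Bz; apply: hB; exists z.
(* Half of the reduced classes, compared by period bounds that lose a factor 2, still carry a
   quarter of the weight up to a bounded error; 1/8 is below that. *)
have [z hz] : exists z, forall y, \sum_(z.+1 <= p < (z + y).+1 | prime p && P p)
    p%:R^-1 <= 8^-1 :> R.
  have sE : has_sup (range e).
    by split; [exists (e 0%N); exists 0%N | exists B => _ [z _ <-]].
  have [|_ [z _ <-] hz] := @sup_adherent R (range e) 8^-1 _ sE; first by [].
  exists z => y; have : e (z + y)%N <= sup (range e).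
    by apply: ub_le_sup; [exact: sE.2 | exists (z + y)%N].
  rewrite {1}/e /prime_recip (big_cat_nat _ (n := z.+1))//= ?ltnS ?leq_addr//.
  by rewrite -/(prime_recip P z) -/(e z); lra.
pose ps := [seq p <- iota 0 z.+1 | prime p && P p].
pose M := (a * \prod_(p <- ps) p)%N.
have M0 : (0 < M)%N.
  rewrite muln_gt0 a0 big_seq prodn_cond_gt0// => p.
  by rewrite mem_filter => /andP[/andP[/prime_gt0]].
have aM : (a %| M)%N by rewrite dvdn_mulr.
(* [c] may share primes with [M]; [r] represents the same class modulo [a] and does not. *)
have [t rM] := coprime_lift ca M0; set r := (c + a * t)%N in rM.
have hr : ~~ h r by rewrite (hmod _ c)// /r addnC mulnC modnMDl.
pose F n := coprime n M; pose F' n := coprime n M && ~~ h n.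
have hcnt := count_units_submonoid h1 hM hmod M0 aM rM hr.
have cntF : (count F (iota 0 M) <= 2 * count F' (iota 0 M))%N.
  have -> : count F (iota 0 M) = (count F' (iota 0 M) +
      count (fun w => coprime w M && h w) (iota 0 M))%N.
    elim: (iota 0 M) => //= w s ->; rewrite /F /F' /=.
    by case: (coprime w M); case: (h w) => /=; lia.
  by rewrite mul2n -addnn leq_add2l.
have cnt0 : (0 < count F' (iota 0 M))%N.
  rewrite -has_count; apply/hasP; exists (r %% M)%N.
    by rewrite mem_iota add0n ltn_pmod.
  by rewrite /F' coprime_modl rM (hmod _ r)// modn_dvdm.
have FM n : F (n + M)%N = F n by rewrite /F -coprime_modl modnDr coprime_modl.
have F'M n : F' (n + M)%N = F' n.
  rewrite /F' -coprime_modl modnDr coprime_modl; congr (_ && ~~ _).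
  by apply: hmod; rewrite -(modn_dvdm _ aM) modnDr modn_dvdm.
(* A bound uniform in [K] contradicts the logarithmic growth of the harmonic sum. *)
suff hD K : \sum_(1 <= k < K.+1) k.+1%:R^-1 <= M%:R ^+ 2 :> R.
  pose K := Num.bound (expR (M%:R ^+ 2 + 1 : R)).
  have := archi_boundP (expR_ge0 (M%:R ^+ 2 + 1 : R)); rewrite -/K => hK.
  have : M%:R ^+ 2 + 1 < ln K.+2%:R :> R.
    rewrite -(expRK (M%:R ^+ 2 + 1)) ltr_ln ?posrE ?expR_gt0//.
    by apply: lt_trans hK _; rewrite ltr_nat.
  have := ln_le_harmonic K.+1; rewrite big_nat_recl//= invr1.
  by have := hD K; lra.
pose N := (M * K.+1).-1.
have NE : N.+1 = (M * K.+1)%N by rewrite prednK// muln_gt0 M0.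
set D := leLHS.
pose T : R := \sum_(1 <= n < N.+1 | F n) n%:R^-1.
pose T' : R := \sum_(1 <= n < N.+1 | F' n) n%:R^-1.
have inv0 n : 0 <= n%:R^-1 :> R by rewrite invr_ge0.
have TX : T <= M%:R + \sum_(M <= n < M * K.+1 | F n) n%:R^-1.
  rewrite /T NE (big_cat_nat _ (n := M))//=; last by rewrite leq_pmulr.
  rewrite lerD2r.
  apply: (@le_trans _ _ (\sum_(1 <= n < M) 1)).
    rewrite big_mkcond big_nat [leRHS]big_nat; apply: ler_sum => n /andP[n1 _].
    by case: ifP => // _; rewrite invf_le1 ?ler1n// ltr0n.
  by rewrite sumr_const_nat ler_nat leq_subr.
have TX' : \sum_(M <= n < M * K.+1 | F' n) n%:R^-1 <= T'.
  rewrite /T' NE [leRHS](big_cat_nat _ (n := M))//=; last by rewrite leq_pmulr.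
  by rewrite lerDr; apply: sumr_ge0.
have TT : T' <= 8^-1 * T.
  have T0 : 0 <= T by apply: sumr_ge0.
  (* Union bound over the primes p > z outside the submonoid; every prime factor of an n <= N is at
     most z + N. *)
  apply: le_trans (ler_wpM2r T0 (hz N)); rewrite mulr_suml.
  apply: (@le_trans _ _ (\sum_(z.+1 <= p < (z + N).+1 | prime p && P p)
      \sum_(1 <= n < N.+1 | F n && (p %| n)%N) n%:R^-1)); last first.
    apply: ler_sum => p /andP[pp _].
    apply: (@sum_multiples_le F (fun n => n%:R^-1)) => //.
    - exact: prime_gt0.
    - by move=> n; rewrite natrM invfM.
    - by move=> m; rewrite /F coprimeMl => /andP[].
  under [leRHS]eq_bigr do rewrite big_mkcond.
  rewrite exchange_big /T' big_mkcond big_nat [leRHS]big_nat; apply: ler_sum => n /andP[n1 nN].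
  case: ifP => [/andP[nM hn]|_]; last by apply: sumr_ge0 => p _; case: ifP.
  have [p [pp pn hp]] : exists p, [/\ prime p, (p %| n)%N & ~~ h p].
    apply: contrapT => np; move/negP: hn; apply.
    apply: submonoid_prime_divisors => // p pp pn.
    by apply: contraT => hp; case: np; exists p.
  have Pp : P p by rewrite /P /= hp (coprime_dvdl pn)// (coprime_dvdr aM).
  have pz : (z < p)%N.
    rewrite ltnNge; apply/negP => pz.
    have pps : p \in ps by rewrite mem_filter mem_iota add0n ltnS pz pp Pp.
    have pM : (p %| M)%N by rewrite /M (big_rem p)//= mulnCA dvdn_mulr.
    have : (p %| gcdn n M)%N by rewrite dvdn_gcd pn pM.
    by rewrite (eqP nM) Euclid_dvd1.
  rewrite big_mkcond (bigD1_seq p) ?iota_uniq//=; last first.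
    rewrite mem_index_iota pz ltnS (leq_trans (dvdn_leq n1 pn))//.
    by rewrite (leq_trans _ (leq_addl _ _)).
  have -> : [&& coprime p a & ~~ h p] by exact: Pp.
  rewrite pp /F nM pn /= lerDl; apply: sumr_ge0 => q _.
  by case: ifP => // _; case: ifP.
have /= /andP[_ u] := harmonic_period_bounds K M0 FM.
have /= /andP[l _] := harmonic_period_bounds K M0 F'M.
rewrite -/D in u l.
set CF : R := (count F _)%:R in u; set CF' : R := (count F' _)%:R in l.
have M0' : 1 <= M%:R :> R by rewrite ler1n.
have D0 : 0 <= D by apply: sumr_ge0.
have c1 : CF <= 2 * CF' by rewrite -natrM ler_nat.
have c2 : 1 <= CF' by rewrite ler1n.
have q0 : 0 <= D / M%:R by rewrite divr_ge0.
have e1 : CF / M%:R * D = CF * (D / M%:R) by rewrite mulrAC mulrA.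
have e2 : CF' / M%:R * D = CF' * (D / M%:R) by rewrite mulrAC mulrA.
have p1 := ler_wpM2r q0 c1; have p2 := ler_wpM2r q0 c2.
rewrite e1 in u; rewrite e2 in l.
have : D / M%:R <= M%:R by lra.
by rewrite ler_pdivrMr -?expr2// (lt_le_trans ltr01).
Qed.

(** * Normal order *)

Lemma omega_inE P z n : omega_in P z n =
  size [seq p <- index_iota 0 z.+1 | [&& prime p, P p & (p %| n)%N]].
Proof.
rewrite size_filter -sum1_count /omega_in big_mkcond [RHS]big_mkcond.
by apply: eq_bigr => p _; rewrite [in RHS]andbA; case: (prime p && P p); case: (p %| n)%N.
Qed.

Definition density_zero (Q : pred nat) := forall g : R, 0 < g ->
  exists N0, forall N, (N0 <= N)%N -> (count Q (index_iota 1 N.+1))%:R <= g * N%:R.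

Lemma density_zero_sub (Q Q' : pred nat) : (forall n, (0 < n)%N -> Q n -> Q' n) ->
  density_zero Q' -> density_zero Q.
Proof.
move=> h dQ g /dQ[N0 hN0]; exists N0 => N /hN0; apply: le_trans.
rewrite ler_nat; apply: leq_count_in => n; rewrite mem_index_iota => /andP[n0 _].
exact: h.
Qed.

Lemma density_zero_has (T : Type) (s : seq T) (Q : T -> pred nat) :
  (forall x, density_zero (Q x)) -> density_zero (fun n => has (Q^~ n) s).
Proof.
move=> dQ; elim: s => [|x s IH] g g0.
  by exists 0%N => N _; rewrite (@eq_count _ _ pred0)// count_pred0 mulr_ge0// ltW.
have g2 : 0 < g / 2 by rewrite divr_gt0.
have [N1 h1] := dQ x _ g2; have [N2 h2] := IH _ g2.
exists (maxn N1 N2) => N; rewrite geq_max => /andP[/h1 k1 /h2 k2].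
apply: (@le_trans _ _ (g / 2 * N%:R + g / 2 * N%:R)); last by rewrite -mulrDl -splitr.
apply: le_trans (lerD k1 k2); rewrite -natrD ler_nat -count_predUI.
exact: leq_addr.
Qed.

(** Choose z with E > 2 K + 12 / g. An [n] without [K] such primes deviates from the mean E by at
    least E / 2, which happens for at most 3 N E / (E / 2)^2 = 12 N / E <= g N integers. *)
Lemma few_prime_factors_density_zero (P : pred nat) (K : nat) :
  (forall B, exists z, B < prime_recip P z) ->
  density_zero (fun n => ~~ `[< exists ps, [/\ uniq ps, size ps = K &
    all (fun p => [&& prime p, P p & (p %| n)%N]) ps] >]).
Proof.
move=> hP g g0.
have [z hz] := hP (2 * K%:R + 12 / g + 1).
exists z => N zN; set E := prime_recip P z in hz.
have K0 : 0 <= K%:R :> R by [].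
have g12 : 0 < 12 / g by rewrite divr_gt0.
have E0 : 0 < E by lra.
have E2 : 0 < E / 2 by rewrite divr_gt0.
apply: (@le_trans _ _ (3 * N%:R * E / (E / 2) ^+ 2)); last first.
  have -> : 3 * N%:R * E / (E / 2) ^+ 2 = 12 / E * N%:R by field; rewrite gt_eqF.
  rewrite ler_wpM2r// ler_pdivrMr// mulrC -ler_pdivrMr//; lra.
apply: le_trans (turan_count P E2 zN).
rewrite ler_nat; apply: sub_count => n /=; rewrite -/E => hn.
have : (omega_in P z n <= K)%N.
  rewrite leqNgt; apply: contra hn => hK; apply/asboolP.
  set s := [seq p <- index_iota 0 z.+1 | [&& prime p, P p & (p %| n)%N]].
  exists (take K s); split.
  - by rewrite take_uniq// filter_uniq// iota_uniq.
  - by rewrite size_takel// -omega_inE ltnW.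
  - by apply/allP => p /mem_take; rewrite mem_filter => /andP[].
rewrite -(ler_nat R) => h; rewrite distrC ler_normr; apply/orP; left.
by rewrite -/E; lra.
Qed.

Lemma ln_ln_unbounded (B : R) :
  exists N0, forall N, (N0 <= N)%N -> B <= ln (ln N%:R) /\ 1 <= ln (N%:R : R).
Proof.
pose C := Num.max B 0.
exists (Num.bound (expR (expR C))) => N hN.
have hC : expR (expR C) <= N%:R.
  apply: le_trans (ltW (archi_boundP (expR_ge0 _))) _.
  by rewrite ler_nat.
have h1 : expR C <= ln N%:R.
  by rewrite -(expRK (expR C)) ler_ln ?posrE ?expR_gt0// (lt_le_trans _ hC) ?expR_gt0.
have h2 : 1 <= expR C by rewrite -expR0 ler_expR /C le_max lexx orbT.
split; last exact: le_trans h1.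
apply: (@le_trans _ _ C); first by rewrite /C le_max lexx.
by rewrite -(expRK C) ler_ln ?posrE ?expR_gt0// (lt_le_trans _ h1) ?expR_gt0.
Qed.

Lemma prime_recip_asymp (h : R) : 0 < h <= 1 -> exists N0, forall N, (N0 <= N)%N ->
  (1 - h) * ln (ln N%:R) <= prime_recip predT N <= (1 + h) * ln (ln N%:R).
Proof.
(* exp d = 1 + h / 2, so half of [h] is spent on the factor exp d and half on absorbing the constant
   [C]. *)
move=> /andP[h0 h1]; pose d := ln (1 + h / 2).
have hh : 0 < h / 2 by rewrite divr_gt0.
have d0 : 0 < d by rewrite ln_gt0// ltrDl.
have d1 : d <= 1.
  by apply: (@le_trans _ _ (h / 2)); [rewrite le_ln1Dx//; lra | lra].
pose C := ln (2 / d) + 1.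
have [N0 hN0] := ln_ln_unbounded (Num.max h^-1 ((1 + h / 2) * C / (h / 2))).
exists (maxn 3 N0) => N; rewrite geq_max => /andP[N3 /hN0[]].
rewrite ge_max => /andP[L1 L2] l1.
have := prime_recip_ge N3; have := prime_recip_le (introT andP (conj d0 d1)) l1.
rewrite lnK ?posrE ?addr_gt0// -[ln _ + _ + _]addrA -/C.
move: (ln (ln _)) L1 L2 => L L1 L2 u l; apply/andP; split.
  have : 1 <= h * L by rewrite -ler_pdivrMl// mulr1.
  lra.
have : (1 + h / 2) * C <= L * (h / 2) by rewrite -ler_pdivrMr.
lra.
Qed.

End prime_sums.

(** * Transfer from prime factors to representations *)

Lemma prod_primes_dvd (n : nat) (s : seq nat) : uniq s ->
  all (fun p => prime p && (p %| n)%N) s -> (\prod_(p <- s) p %| n)%N.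
Proof.
elim: s => [|p s IH] /=; first by rewrite big_nil dvd1n.
move=> /andP[ps us] /andP[/andP[pp pn] hs]; rewrite big_cons Gauss_dvd.
  by rewrite pn IH.
rewrite big_seq; apply: (big_ind (fun x => coprime p x)).
- exact: coprimen1.
- by move=> x y px py; rewrite coprimeMr px.
- move=> q qs; have /andP[qp _] := allP hs _ qs.
  by rewrite prime_coprime// dvdn_prime2//; apply: contraNneq ps => ->.
Qed.

(** A prime factor of [n] missing from [ps] lies in [T] or divides [a], and is then at most [a];
    this loses at most 2 a + 1 primes. Exponents on [ps] are free, with [T] correcting the class. *)
Lemma pow3_omega_le (n a : nat) (T : seq nat) :
  (0 < n)%N -> (0 < a)%N -> uniq T -> (size T <= a)%N ->
  all (fun p => [&& prime p, p %| n & coprime p a]%N) T ->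
  (forall c, coprime c a ->
     exists2 u, u \in divisors (\prod_(p <- T) p) & u = c %[mod a]) ->
  (3 ^ size (primes n) <= 3 ^ (2 * a + 1) * num_egyptian_pairs n a)%N.
Proof.
move=> n0 a0 uT sT aT cover.
pose ps := [seq p <- primes n | coprime p a & p \notin T].
have psP p : p \in ps -> [/\ prime p, (p %| n)%N, coprime p a & p \notin T].
  by rewrite mem_filter mem_primes => /andP[/andP[-> ->] /and3P[-> _ ->]].
have ups : uniq ps by rewrite filter_uniq// primes_uniq.
have cnt : (size (primes n) <= size ps + (2 * a + 1))%N.
  apply: (@leq_trans (size (ps ++ T ++ iota 0 a.+1))); last first.
    by rewrite !size_cat size_iota; lia.
  apply: uniq_leq_size; first exact: primes_uniq.
  move=> p pn; rewrite !mem_cat mem_filter pn andbT mem_iota add0n ltnS.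
  case: (p \in T); rewrite ?orbT//= andbT.
  have [//|] := boolP (coprime p a).
  move: pn; rewrite mem_primes => /and3P[pp _ _].
  by rewrite prime_coprime// negbK => /dvdn_leq ->.
pose m := (\prod_(p <- T) p)%N.
have mE : (m * \prod_(p <- ps) p = \prod_(p <- T ++ ps) p)%N by rewrite big_cat.
have aTps : all (fun p => [&& prime p, p %| n & coprime p a]%N) (T ++ ps).
  by rewrite all_cat aT /=; apply/allP => p /psP[-> -> ->].
have uTps : uniq (T ++ ps).
  by rewrite cat_uniq uT ups andbT /=; apply/hasPn => p /psP[].
have dn : (m * \prod_(p <- ps) p %| n)%N.
  rewrite mE prod_primes_dvd//; apply/allP => p /(allP aTps) /and3P[-> ->].
  by [].
have ca : coprime (m * \prod_(p <- ps) p) a.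
  rewrite mE big_seq; apply: (big_ind (fun x => coprime x a)).
  - exact: coprime1n.
  - by move=> x y xa ya; rewrite coprimeMl xa.
  - by move=> p /(allP aTps) /and3P[].
have [c cca hc] := num_egyptian_pairs_ge n0 a0 dn ca.
have m0 : (0 < m)%N.
  by apply: dvdn_gt0 n0 _; apply: dvdn_trans dn; rewrite dvdn_mulr.
have psm : all (fun p => [&& prime p, coprime p m & coprime p a]) ps.
  apply/allP => p /psP[pp pn pa pT]; rewrite pp pa andbT /=.
  rewrite /m big_seq; apply: (big_ind (fun x => coprime p x)).
  - exact: coprimen1.
  - by move=> x y px py; rewrite coprimeMr px.
  - move=> q qT; have /and3P[qp _ _] := allP aT _ qT.
    by rewrite prime_coprime// dvdn_prime2//; apply: contraNneq pT => ->.
have := leq_trans (count_divisors_residue a0 m0 ups psm cover cca) hc.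
move=> hk; apply: (@leq_trans (3 ^ (2 * a + 1) * 3 ^ size ps)).
  by rewrite -expnD leq_exp2l// addnC.
by rewrite leq_mul2l hk orbT.
Qed.

(** There are finitely many sets [S]. For one that some unit fails to stabilize, almost all [n] have
    [a] prime factors that also fail to. Outside the union of the exceptional sets the covering
    family exists. *)
Lemma pow3_omega_le_density (R : realType) (a : nat) : (0 < a)%N ->
  density_zero R (fun n =>
    ~~ (3 ^ size (primes n) <= 3 ^ (2 * a + 1) * num_egyptian_pairs n a)%N).
Proof.
move=> a0.
pose Q (S : {set 'I_a}) n := `[< exists c, coprime c a /\ ~~ stabilizes S c >] &&
  ~~ `[< exists ps, [/\ uniq ps, size ps = a &
    all (fun p => [&& prime p, coprime p a && ~~ stabilizes S p & (p %| n)%N]) ps] >].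
have dQ S : density_zero R (Q S).
  rewrite /Q; have [[c [ca hc]]|hc] := pselect (exists c, coprime c a /\ ~~ stabilizes S c).
    apply: density_zero_sub (few_prime_factors_density_zero (R := R)
      (P := [pred p | coprime p a && ~~ stabilizes S p]) a _).
      by move=> n _ /andP[_].
    apply: (prime_recip_unbounded (c := c)) => //.
    - exact: stabilizes1.
    - exact: stabilizesM.
    - exact: stabilizes_mod.
  move=> g g0; exists 0%N => N _.
  rewrite (@eq_count _ _ pred0) ?count_pred0 ?mulr_ge0// ?ltW// => n /=.
  by apply/negP => /andP[/asboolP].
apply: density_zero_sub (density_zero_has (enum {set 'I_a}) dQ).
move=> n n0; apply: contraR => /hasPn hQ.
have [|T [uT sT aT hT]] := @divisor_residues_cover a a0 n.
  move=> S c ca hc; have := hQ S; rewrite mem_enum => /(_ isT).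
  rewrite /Q negb_and negbK => /orP[/asboolP[]|/asboolP[ps [ups sps aps]]].
    by exists c.
  exists ps; split => //; apply/allP => p /(allP aps) /and3P[-> /andP[-> ->] ->].
  by [].
exact: (pow3_omega_le n0 a0 uT sT aT hT).
Qed.

Lemma count_index_iota_le (P : pred nat) (m k N : nat) : (m <= k)%N ->
  (count P (index_iota k N) <= count P (index_iota m N))%N.
Proof.
move=> mk; rewrite -!size_filter; apply: uniq_leq_size => [|n].
  by rewrite filter_uniq// iota_uniq.
rewrite !mem_filter !mem_index_iota => /and3P[-> kn ->].
by rewrite (leq_trans mk kn).
Qed.

Lemma omega_in_primes (N n : nat) : (0 < n)%N ->
  (omega_in predT N n <= size (primes n))%N.
Proof.
move=> n0; rewrite omega_inE; apply: uniq_leq_size.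
  by rewrite filter_uniq// iota_uniq.
by move=> p; rewrite mem_filter mem_primes n0 => /andP[/and3P[-> _ ->]].
Qed.

Lemma num_egyptian_pairs_le_pow3 (N n a : nat) : (0 < n <= N)%N -> (0 < a)%N ->
  (num_egyptian_pairs n a <= 3 ^ (omega_in predT N n + omega_excess N n))%N.
Proof.
move=> /andP[n0 nN] a0; apply: leq_trans (num_egyptian_pairs_le n0 a0) _.
apply: leq_trans (@size_divisors_sqr N n _) _; first by rewrite n0.
by rewrite leq_exp2l// sum_logn_le// n0.
Qed.

(** With W the number of primes of [n] and X the excess, ln R(n; a) / ln 3 lies between W - (2 a +
    1) and W + X. Passing from W to E costs h E <= 2 h L, from E to L costs h L, and K <= h L - 1,
    whose 1 pays for ln ln n >= L - 1. The total 4 h L is at most eps ln ln n, as ln ln n >= L /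
    2. *)
Lemma num_egyptian_pairs_within (R : realType) (a N n : nat) (eps h K E : R) :
  (0 < a)%N -> (1 < n <= N)%N -> (N <= n ^ 2)%N ->
  (3 ^ size (primes n) <= 3 ^ (2 * a + 1) * num_egyptian_pairs n a)%N ->
  (2 * a + 1)%N%:R <= K -> (omega_excess N n)%:R <= K ->
  `|(omega_in predT N n)%:R - E| < h * E ->
  0 < h -> 8 * h <= 1 -> 8 * h <= eps ->
  let L := ln (ln N%:R) in
  (1 - h) * L <= E <= (1 + h) * L -> 2 <= L -> K + 1 <= h * L ->
  (`|lne ((num_egyptian_pairs n a)%:R%:E : \bar R) - (ln 3 * ln (ln n%:R))%:E| <=
   (eps * (ln 3 * ln (ln n%:R)))%:E)%E.
Proof.
move=> a0 /andP[n1' nN] q4 q1 KA KX q2 h0 h1 he L /andP[EL EU] L2 KL.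
have n0 : (0 < n)%N := ltnW n1'.
have n1 : 1 < n%:R :> R by rewrite ltr1n.
have lN : 0 < ln N%:R :> R by rewrite ln_gt0// ltr1n (leq_trans n1').
set r := num_egyptian_pairs n a in q1 *; set W := omega_in predT N n in q2.
set X := omega_excess N n in KX.
have up : (r <= 3 ^ (W + X))%N by apply: num_egyptian_pairs_le_pow3; rewrite ?n0.
have lo : (3 ^ W <= 3 ^ (2 * a + 1) * r)%N.
  by apply: leq_trans q1; rewrite leq_exp2l// omega_in_primes.
have r0 : (0 < r)%N by move: lo; case: (r) => //; rewrite muln0 leqn0 expn_eq0.
have r0' : 0 < r%:R :> R by rewrite ltr0n.
(* [r] is positive, so the value -oo does not occur. *)
rewrite /lne ifF /=; last by rewrite leNgt r0'.
rewrite lee_fin.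
have l3 : 0 < ln 3 :> R by rewrite ln_gt0// ltr1n.
have lnX k : ln (3 ^ k)%N%:R = k%:R * ln 3 :> R.
  by rewrite natrX lnXn ?mulr_natl// ltr0n.
have up' : ln r%:R <= (W%:R + X%:R) * ln 3 :> R.
  by rewrite -natrD -lnX ler_ln ?posrE ?ltr0n ?expn_gt0// ler_nat.
have lo' : W%:R * ln 3 <= (2 * a + 1)%N%:R * ln 3 + ln r%:R :> R.
  rewrite -!lnX -lnM ?posrE ?ltr0n ?expn_gt0// -natrM.
  by rewrite ler_ln ?posrE ?ltr0n ?muln_gt0 ?expn_gt0// ler_nat.
set l := ln (ln n%:R).
have ln0 : 0 < ln n%:R :> R by rewrite ln_gt0.
have lL : l <= L.
  have nN' : ln n%:R <= ln N%:R :> R by rewrite ler_ln ?posrE ?ltr0n ?(leq_trans n0 nN) ?ler_nat.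
  by rewrite /l /L ler_ln ?posrE// (lt_le_trans ln0).
(* From N <= n^2 follows ln N <= 2 ln n, and ln 2 <= 1. *)
have Ll : L - 1 <= l.
  have : ln N%:R <= 2 * ln n%:R :> R.
    rewrite mulr_natl -lnXn ?ltr0n// -natrX ler_ln ?posrE ?ltr0n ?expn_gt0 ?n0// ?ler_nat//.
    exact: leq_trans n0 nN.
  move=> nN'; have : L <= ln (2 * ln n%:R).
    by rewrite /L ler_ln ?posrE ?mulr_gt0.
  rewrite lnM ?posrE//; rewrite -/l.
  have : ln 2 <= 1 :> R.
    have -> : 2 = 1 + 1 :> R by [].
    by rewrite le_ln1Dx.
  lra.
move: q2; rewrite ltr_distl => /andP[q2 q2'].
have L0 : 0 <= L by apply: le_trans L2.
have hL : 8 * h * L <= L by rewrite ler_piMl.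
have EL2 : h * E <= 2 * (h * L).
  by rewrite mulrCA ler_wpM2l ?(ltW h0)//; lra.
have hl : 4 * (h * L) <= eps * l.
  have : 8 * h * (L / 2) <= eps * l by apply: ler_pM => //; lra.
  lra.
have c1 : W%:R + X%:R <= l + eps * l by lra.
have c2 : l - eps * l <= W%:R - (2 * a + 1)%N%:R by lra.
have d1 := ler_wpM2r (ltW l3) c1; have d2 := ler_wpM2r (ltW l3) c2.
have -> : eps * (ln 3 * l) = eps * l * ln 3 by ring.
rewrite ler_distl [ln 3 * l]mulrC; apply/andP; split.
  by apply: (@le_trans _ _ ((l - eps * l) * ln 3)); [rewrite mulrBl|lra].
by apply: (@le_trans _ _ ((l + eps * l) * ln 3)); [lra|rewrite mulrDl].
Qed.

(** Four exceptional sets have at most g N / 4 members each: the lower bound for R(n; a) fails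
    ([Q1]), omega is far from its mean ([Q2]), repeated prime factors abound ([Q3]), or n^2 < N
    ([Q4]). *)
Lemma count_exceptional_le (R : realType) (a : nat) (eps g : R) : (0 < a)%N -> 0 < eps -> 0 < g ->
  exists N0, forall N, (N0 <= N)%N ->
    (count (fun n => ~~ (`|lne ((num_egyptian_pairs n a)%:R%:E : \bar R) -
                           (ln 3 * ln (ln n%:R))%:E| <= (eps * (ln 3 * ln (ln n%:R)))%:E)%E)
       (index_iota 3 N.+1))%:R <= g * N%:R.
Proof.
move=> a0 e0 g0.
pose h : R := Num.min 1 eps / 8.
have m0 : 0 < Num.min 1 eps :> R by rewrite lt_min ltr01.
have m1 : Num.min 1 eps <= 1 :> R by rewrite ge_min lexx.
have me : Num.min 1 eps <= eps :> R by rewrite ge_min lexx orbT.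
have h0 : 0 < h by rewrite divr_gt0.
have h1 : 8 * h <= 1 by rewrite /h; lra.
have he : 8 * h <= eps by rewrite /h; lra.
have g4 : 0 < g / 4 by rewrite divr_gt0.
(* [K] dominates both bounded losses; by Markov the excess reaches 4 / g for at most g N / 4
   integers. *)
pose K : R := Num.max (2 * a + 1)%N%:R (4 / g).
have K0 : 0 < K by rewrite lt_max divr_gt0 ?orbT.
have hh : 0 < h <= 1 by rewrite h0; lra.
have [N1 hN1] := @pow3_omega_le_density R a a0 _ g4.
have [N2 hN2] := prime_recip_asymp hh.
(* 2 and (K + 1) / h serve [num_egyptian_pairs_within]; 24 / (h^2 g) makes the Chebyshev bound 3 /
   (h^2 E), with E >= L / 2, at most g / 4. *)
have [N3 hN3] := ln_ln_unbounded (Num.max 2 (Num.max ((K + 1) / h) (24 / (h ^+ 2 * g)))).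
(* sqrt N <= g N / 4 once N >= 16 / g^2. *)
pose N4 := (Num.bound (16 / g ^+ 2)).+1.
exists (maxn (maxn N1 N2) (maxn N3 N4)) => N.
rewrite !geq_max => /andP[/andP[/hN1 b1 /hN2 hE12] /andP[/hN3[+ lN] NN4]].
rewrite !ge_max => /and3P[L2 Lh Lg]; move: hE12 => /andP[].
set E := prime_recip R predT N; set L := ln (ln N%:R) in L2 Lh Lg * => EL EU.
have E0 : 0 < E by apply: lt_le_trans EL; rewrite mulr_gt0; lra.
have hE : 0 < h * E by rewrite mulr_gt0.
pose Q1 n := ~~ (3 ^ size (primes n) <= 3 ^ (2 * a + 1) * num_egyptian_pairs n a)%N.
pose Q2 n := (h * E <= `|(omega_in predT N n)%:R - E|).
pose Q3 n := 4 / g <= (omega_excess N n)%:R :> R.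
pose Q4 n := (n ^ 2 < N)%N.
rewrite -/Q1 in b1.
have b2 : (count Q2 (index_iota 1 N.+1))%:R <= g / 4 * N%:R.
  apply: le_trans (turan_count predT hE (leqnn N)) _; rewrite -/E.
  have -> : 3 * N%:R * E / (h * E) ^+ 2 = 3 / (h ^+ 2 * E) * N%:R.
    by field; rewrite !gt_eqF.
  rewrite ler_wpM2r// ler_pdivrMr ?mulr_gt0 ?exprn_gt0//.
  have EL2 : L / 2 <= E.
    apply: le_trans EL; rewrite mulrC ler_wpM2r; lra.
  have hg : 0 < h ^+ 2 * g by rewrite mulr_gt0 ?exprn_gt0.
  have : 24 <= L * (h ^+ 2 * g) by rewrite -ler_pdivrMr.
  have := ler_wpM2r (ltW hg) EL2; lra.
have b3 : (count Q3 (index_iota 1 N.+1))%:R <= g / 4 * N%:R.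
  have g40 : 0 < 4 / g by rewrite divr_gt0.
  by apply: le_trans (count_omega_excess N g40) _; rewrite invf_div mulrC.
have b4 : (count Q4 (index_iota 1 N.+1))%:R <= g / 4 * N%:R.
  (* If there were k of them with N < k^2, all would be positive and below k, leaving room for only
     k - 1. *)
  have sq : (count Q4 (index_iota 1 N.+1) ^ 2 <= N)%N.
    rewrite leqNgt; apply/negP; rewrite -size_filter; set k := size _ => Nk.
    have k0 : (0 < k)%N by case: (k) Nk => //; rewrite exp0n.
    suff : (k <= k.-1)%N by rewrite -ltnS prednK// ltnn.
    rewrite -[k.-1](size_iota 1); apply: uniq_leq_size.
      by rewrite filter_uniq// iota_uniq.
    move=> n; rewrite mem_filter mem_index_iota mem_iota => /and3P[nN -> _] /=.
    rewrite add1n prednK//; have := ltn_trans nN Nk.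
    by rewrite ltn_exp2r.
  have gN0 : 0 <= g / 4 * N%:R by rewrite mulr_ge0// ltW.
  rewrite -ler_sqr ?nnegrE//.
  apply: (@le_trans _ _ N%:R); first by move: sq; rewrite -(ler_nat R) natrX.
  have hb : 16 / g ^+ 2 <= N%:R.
    apply: le_trans (ltW (archi_boundP _)) _; first by rewrite divr_ge0// sqr_ge0.
    by rewrite ler_nat (leq_trans _ NN4).
  have -> : (g / 4 * N%:R) ^+ 2 = (N%:R * (g ^+ 2 / 16)) * N%:R by field.
  rewrite -[leLHS]mul1r ler_wpM2r//.
  have : 16 <= N%:R * g ^+ 2 by rewrite -ler_pdivrMr// exprn_gt0.
  by lra.
apply: (@le_trans _ _ ((count Q1 (index_iota 1 N.+1))%:R + (count Q2 (index_iota 1 N.+1))%:R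
    + (count Q3 (index_iota 1 N.+1))%:R + (count Q4 (index_iota 1 N.+1))%:R)); last first.
  have -> : g * N%:R = g / 4 * N%:R + g / 4 * N%:R + g / 4 * N%:R + g / 4 * N%:R by field.
  by rewrite !lerD.
rewrite -!natrD ler_nat.
apply: (@leq_trans (count (predU (predU (predU Q1 Q2) Q3) Q4) (index_iota 1 N.+1))); last first.
  have cU (P Q : pred nat) s : (count (predU P Q) s <= count P s + count Q s)%N.
    by rewrite -count_predUI leq_addr.
  apply: leq_trans (cU _ _ _) _; rewrite leq_add2r.
  by apply: leq_trans (cU _ _ _) _; rewrite leq_add2r.
apply: (@leq_trans (count (predU (predU (predU Q1 Q2) Q3) Q4) (index_iota 3 N.+1))); last first.
  exact: count_index_iota_le.
apply: leq_count_in => n; rewrite mem_index_iota ltnS => /andP[n3 nN].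
apply: contraR; rewrite /= !negb_or /Q1 /Q2 /Q3 /Q4 negbK -!ltNge -leqNgt.
move=> /andP[/andP[/andP[q1 q2] q3] q4].
apply: (num_egyptian_pairs_within (N := N) (K := K) (h := h) (E := E)) => //.
- by rewrite nN (ltn_trans _ n3).
- by rewrite /K le_max lexx.
- by rewrite /K le_max (ltW q3) orbT.
- by rewrite EL EU.
- by rewrite mulrC -ler_pdivrMr.
Qed.

Theorem theorem2 (R : realType) (a : nat) (ha : (0 < a)%N) :
  normal_order (fun n => lne ((num_egyptian_pairs n a)%:R%:E : \bar R))
               (fun n => ln 3 * ln (ln n%:R)).
Proof.
move=> eps eps0; apply/eqoP => g g0.
have [N0 hN0] := count_exceptional_le ha eps0 g0.
by exists N0 => // N /= /hN0; rewrite !ger0_norm.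
Qed.
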